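(* Let $G$ be a finite graph (multiple edges allowed) with vertex set $V$, edge set $E$, each edge joining two distinct vertices, every vertex of positive degree, and maximum vertex degree $d_{\max}(G)$. Let $P(z)=\sum_{m}p_mz^m$ where $p_m$ is the number of matchings of $G$ with $m$ edges (i.e. subsets $M\subset E$ such that each vertex is incident to at most one edge of $M$), and let $X_P$ be a random variable with $\Pr(X_P=m)=p_m/P(1)$. If $|E|\ge2.2\times10^8\,d_{\max}^4(G)$, then $$\sup_{m\in\mathbb{Z}}\left|\Pr(X_P=m)-\frac{1}{\sqrt{2\pi\operatorname{Var}(X_P)}}\exp\left(-\frac{(m-E[X_P])^2}{2\operatorname{Var}(X_P)}\right)\right|\le\frac{200\,d_{\max}^4(G)}{\pi|E|}.$$ *)

(* Defs.v *)
From mathcomp Require Import all_boot all_order all_algebra.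

Set Implicit Arguments.
Unset Strict Implicit.
Unset Printing Implicit Defensive.

Import GRing.Theory.
Local Open Scope ring_scope.

(* Finite loopless multigraph: an edge is an abstract object with a
   two-element set of end points, so parallel edges are distinct elements
   of [edge G]. *)
Record multigraph := Multigraph {
  vertex : finType;
  edge : finType;
  ends : edge -> {set vertex};
  card_ends : forall e : edge, #|ends e| = 2%N }.

Section Matchings.
Variable G : multigraph.

Definition incident_edges (v : vertex G) : {set edge G} :=
  [set e | v \in ends e].

Definition degree (v : vertex G) : nat := #|incident_edges v|.

Definition max_degree : nat := (\max_(v : vertex G) degree v)%N.

Definition is_matching (M : {set edge G}) : bool :=
  [forall v : vertex G, #|M :&: incident_edges v| <= 1]%N.

Definition num_matchings (m : nat) : nat :=
  #|[set M : {set edge G} | is_matching M & #|M| == m]|.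

(* Matchings have at most #|edge G| edges, so no coefficient is cut off. *)
Definition matching_poly (R : nzRingType) : {poly R} :=
  \poly_(m < #|edge G|.+1) (num_matchings m)%:R.

End Matchings.

(* Main.v *)
(* The statistic X is the size of a uniformly random matching.  Two facts about
   it are combined.

   Its generating function has only real roots (Heilmann-Lieb): if z = w^2 with
   Re w > 0, the ratios Z(S) / (w Z(S - u)) of matching sums of induced
   subgraphs stay in the right half plane, by induction on the vertex set S.
   Hence P(z)/P(1) is a product of factors (1 - q) + q z with 0 <= q <= 1, and X
   is distributed as a sum of independent Bernoulli variables.  Comparing the
   characteristic function with that of the Gaussian on [0, pi], factor by
   factor, gives a local limit theorem with error 23 / (pi Var X).

   Its variance is at least |E| / (4 d^2): this is the Cauchy-Schwarz inequality
   against the sum over the edges e of the sign that is 1 if e lies in the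
   matching, -1 if e can be added to it, and 0 otherwise. *)

Require Import Defs.
From HB Require Import structures.
From mathcomp Require Import all_boot all_order all_algebra.
From mathcomp Require Import ring lra zify.
From mathcomp Require Import all_classical all_reals all_analysis.
From mathcomp Require Import measurable_realfun complex.

Set Implicit Arguments.
Unset Strict Implicit.
Unset Printing Implicit Defensive.

Import Order.TTheory GRing.Theory Num.Theory.
Import numFieldNormedType.Exports.
Local Open Scope ring_scope.

(** * Matching sums of induced subgraphs and their vertex recurrence *)

Section SubgraphPolynomial.
Variable G : multigraph.
Implicit Types (M : {set edge G}) (S : {set vertex G}) (e f : edge G).

(** Induced subgraphs are represented by vertex sets, so the edge type stays fixed during the
    induction on vertices. *)
Definition matchings_in S : {set {set edge G}} :=
  [set M | is_matching M & [forall e in M, ends e \subset S]].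

Definition matching_sum (A : comNzRingType) (z : A) S : A :=
  \sum_(M in matchings_in S) z ^+ #|M|.

Lemma is_matchingP M :
  reflect {in M &, forall e f, e != f -> [disjoint ends e & ends f]}
          (is_matching M).
Proof.
apply: (iffP forallP) => [mM e f eM fM ef|dM v].
  rewrite -setI_eq0; apply/eqP/setP => v; rewrite !inE.
  apply/negP => /andP[ve vf].
  have : [set e; f] \subset M :&: incident_edges v.
    apply/fintype.subsetP => g.
    by rewrite !inE => /orP[]/eqP->; rewrite ?eM ?fM ?ve ?vf.
  move/subset_leq_card; rewrite cards2 ef => /leq_trans/(_ (mM v)).
  by rewrite ltnn.
apply/card_le1_eqP => e f; rewrite !inE => /andP[eM ve] /andP[fM vf].
apply/eqP/negP => /negP ef; have := dM f e fM eM ef.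
by move/disjointFl/(_ ve); rewrite vf.
Qed.

Lemma matchings_inP S M :
  reflect (is_matching M /\ {in M, forall e, ends e \subset S})
          (M \in matchings_in S).
Proof.
by rewrite inE; apply: (iffP andP) => -[mM /forall_inP sM]; split => //;
  apply/forall_inP.
Qed.

Lemma is_matchingS M (N : {set edge G}) :
  N \subset M -> is_matching M -> is_matching N.
Proof.
move=> /fintype.subsetP NM /is_matchingP mM; apply/is_matchingP.
move=> e f /NM eM /NM fM.
exact: mM.
Qed.

(** An edge inside [S] is disjoint from [e] exactly when it survives the removal of both ends of
    [e]. *)
Lemma matchings_in_setU1 S e M : ends e \subset S -> e \notin M ->
  (e |: M \in matchings_in S) = (M \in matchings_in (S :\: ends e)).
Proof.
move=> eS eM; apply/matchings_inP/matchings_inP => -[mM sM]; split.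
- by apply: is_matchingS mM; exact: finset.subsetUr.
- move=> f fM; rewrite subsetD sM ?inE ?fM ?orbT//=.
  move/is_matchingP: mM; apply; rewrite ?inE ?fM ?eqxx ?orbT//.
  by apply: contraNneq eM => <-.
- apply/is_matchingP => f g; rewrite !inE => /predU1P[->|fM] /predU1P[->|gM].
  + by rewrite eqxx.
  + by move=> _; have := sM _ gM; rewrite subsetD disjoint_sym => /andP[].
  + by move=> _; have := sM _ fM; rewrite subsetD => /andP[].
  + by move/is_matchingP: mM; exact.
- move=> f; rewrite !inE => /predU1P[->//|fM].
  by have := sM _ fM; rewrite subsetD => /andP[].
Qed.

Lemma matchings_in_setD1 S u M :
  (M \in matchings_in (S :\ u)) =
  (M \in matchings_in S) && (#|M :&: incident_edges u| == 0)%N.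
Proof.
rewrite cards_eq0; apply/matchings_inP/andP.
  move=> [mM sM]; split.
    by apply/matchings_inP; split=> // e /sM; rewrite subsetD1 => /andP[].
  apply/eqP/setP => e; rewrite !inE; apply/negP => /andP[/sM].
  by rewrite subsetD1 => /andP[_ /negP].
move=> [/matchings_inP[mM sM] /eqP/setP eM]; split => // e eMe.
by rewrite subsetD1 sM//=; have := eM e; rewrite !inE eMe/= => ->.
Qed.

(** A matching either misses [u] or has exactly one edge at [u]; that edge contributes a factor [z]
    and uses up both of its ends. Parallel edges give separate terms. *)
Lemma matching_sum_rec (A : comNzRingType) (z : A) S u : u \in S ->
  matching_sum z S = matching_sum z (S :\ u) +
    z * \sum_(e in incident_edges u | ends e \subset S)
          matching_sum z (S :\: ends e).
Proof.
move=> uS.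
(* At most one edge of [M] meets [u], so exactly one summand on the right is [z ^+ #|M|] and the
   others vanish. *)
have split1 M : M \in matchings_in S -> z ^+ #|M| =
    (if (#|M :&: incident_edges u| == 0)%N then z ^+ #|M| else 0) +
    \sum_(e in incident_edges u | ends e \subset S)
      (if e \in M then z ^+ #|M| else 0).
  move=> /matchings_inP[/forallP/(_ u) mM sM].
  rewrite -big_mkcondr/= sumr_const.
  rewrite [X in _ *+ X](_ : _ = #|M :&: incident_edges u|); last first.
    apply: eq_card => e; rewrite !inE -[in LHS]topredE /= !inE andbC.
    by case eM: (e \in M) => //=; rewrite sM ?andbT.
  move: mM; case: (#|M :&: _|) => [|[|]]//= _; first by rewrite mulr0n addr0.
  by rewrite mulr1n add0r.
rewrite {1}/matching_sum (eq_bigr _ split1) big_split/=; congr (_ + _).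
  rewrite -big_mkcondr/=; apply: eq_bigl => M.
  by rewrite matchings_in_setD1.
rewrite exchange_big/= mulr_sumr; apply: eq_bigr => e /andP[eu eS].
rewrite -big_mkcondr/= mulr_sumr.
rewrite (reindex_onto (fun M => e |: M) (fun M => M :\ e))/=; last first.
  by move=> M /andP[_ eM]; rewrite finset.setD1K.
(* [ends e] is not empty, so [e] cannot lie in a subgraph that avoids its own ends; hence adding and
   deleting [e] are mutually inverse. *)
have emem M : (M \in matchings_in (S :\: ends e)) -> e \notin M.
  move=> /matchings_inP[_ sM]; apply/negP => /sM; rewrite subsetD => /andP[_].
  move/disjoint_setI0; rewrite finset.setIid => e0.
  by have := card_ends e; rewrite e0 cards0.
rewrite (eq_bigl (mem (matchings_in (S :\: ends e)))); last first.
  move=> M; rewrite finset.setU11 andbT /=.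
  have [eM|eM] := boolP (e \in M).
    apply/andP/idP => [[_ /eqP MM]|/emem]; last by rewrite eM.
    by move: eM; rewrite -MM !inE eqxx.
  by rewrite matchings_in_setU1// finset.setU1K ?eqxx ?andbT.
by apply: eq_bigr => M /emem eM; rewrite cardsU1 eM exprS.
Qed.

Lemma matching_sum0 (A : comNzRingType) (z : A) : matching_sum z finset.set0 = 1.
Proof.
rewrite /matching_sum (big_pred1 finset.set0) ?cards0// => M /=.
apply/matchings_inP/eqP => [[_ sM]|->].
  apply/setP => e; rewrite inE; apply/negP => /sM.
  by rewrite finset.subset0 -cards_eq0 card_ends.
by split=> [|e]; [apply/is_matchingP => e f|]; rewrite inE.
Qed.

Lemma horner_matching_poly (A : comNzRingType) (z : A) :
  (matching_poly G A).[z] = matching_sum z finset.setT.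
Proof.
have -> : matching_poly G A =
    \sum_(M : {set edge G} | is_matching M) 'X^#|M|.
  apply/polyP => m; rewrite coef_poly coef_sum.
  under eq_bigr do rewrite coefXn mulrb.
  rewrite -big_mkcondr/=.
  have -> : num_matchings G m =
      #|[pred M : {set edge G} | is_matching M && (m == #|M|)]|.
    by apply: eq_card => M; rewrite !inE eq_sym.
  rewrite sumr_const; case: ltnP => // mE.
  rewrite eq_card0// => M; rewrite !inE; apply/negP => /andP[_ /eqP mM].
  by have := max_card M; rewrite -mM leqNgt mE.
rewrite horner_sum; under eq_bigr do rewrite hornerXn.
apply: eq_bigl => M; rewrite inE; case: (is_matching M) => //=.
by symmetry; apply/forall_inP => e _; exact: finset.subsetT.
Qed.

End SubgraphPolynomial.

(** * Real-rootedness of the matching polynomial and its Bernoulli factors *)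

Section HeilmannLieb.
Local Open Scope complex_scope.
Variable R : rcfType.
Implicit Types (w z x y : R[i]).

Let ReD x y : complex.Re (x + y) = complex.Re x + complex.Re y.
Proof. by case: x y => [? ?] [? ?]. Qed.

Let ReV_gt0 x : 0 < complex.Re x -> 0 < complex.Re x^-1.
Proof.
case: x => a b /= a0; rewrite divr_gt0// ltr_pwDl ?exprn_gt0//; exact: sqr_ge0.
Qed.

(** The right half plane is stable under sums and inverses. The two claims feed each other:
    nonvanishing for [S :\ u] makes the ratio at [u] meaningful, and its positive real part forces
    nonvanishing for [S]. *)
Lemma Re_matching_sum_gt0 (G : multigraph) w (S : {set vertex G}) :
  0 < complex.Re w ->
  matching_sum (w ^+ 2) S != 0 /\
  {in S, forall u,
    0 < complex.Re (matching_sum (w ^+ 2) S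
                    / (w * matching_sum (w ^+ 2) (S :\ u)))}.
Proof.
move=> w0; have wN0 : w != 0 by apply: contraTneq w0 => ->; rewrite /= ltxx.
move: {2}#|S| (leqnn #|S|) => n; elim: n S => [|n IH] S.
  rewrite leqn0 cards_eq0 => /eqP ->; split=> [|u]; last by rewrite inE.
  by rewrite matching_sum0 oner_eq0.
move=> Sn.
have ratio : {in S, forall u, 0 < complex.Re (matching_sum (w ^+ 2) S
                    / (w * matching_sum (w ^+ 2) (S :\ u)))}.
  move=> u uS; have Sun : (#|S :\ u| <= n)%N.
    by move: Sn; rewrite (cardsD1 u) uS.
  have [Z0 pos] := IH _ Sun.
  set Z := matching_sum _ (S :\ u) in Z0 pos *.
  (* The ratio at [u] is [w^-1] plus inverses of ratios of [S :\ u]. *)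
  rewrite (matching_sum_rec _ uS) -/Z.
  rewrite [X in complex.Re X](_ : _ = w^-1 +
      \sum_(e in incident_edges u | ends e \subset S)
          (Z / (w * matching_sum (w ^+ 2) (S :\: ends e)))^-1); last first.
    rewrite mulrDl invfM mulrCA divff// mulr1; congr (_ + _).
    rewrite mulrAC mulr_sumr; apply: eq_bigr => e _.
    by rewrite invfM invrK; field; rewrite wN0 Z0.
  rewrite ReD ltr_pwDl ?ReV_gt0//.
  apply: (big_ind (fun x => 0 <= complex.Re x)) => //.
    by move=> x y x0 y0; rewrite ReD addr_ge0.
  move=> e /andP[]; rewrite inE => ue eS; apply/ltW/ReV_gt0.
  (* The other end [v] of [e] turns the removal of [ends e] into that of [u] and then [v], which is
     the ratio of the induction hypothesis at [v]. *)
  have : #|ends e :\ u| == 1%N.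
    by have := card_ends e; rewrite (cardsD1 u) ue add1n => -[->].
  move=> /cards1P[v eu].
  have -> : S :\: ends e = (S :\ u) :\ v.
    by rewrite -(finset.setD1K ue) eu -finset.setDDl.
  apply: pos; have : v \in ends e :\ u by rewrite eu inE.
  by rewrite !inE => /andP[->] /= /(fintype.subsetP eS).
split=> //; have [->|[u uS]] := finset.set_0Vmem S.
  by rewrite matching_sum0 oner_eq0.
by apply: contraTneq (ratio u uS) => ->; rewrite mul0r ltxx.
Qed.

(** If a square root of [z] is not purely imaginary, it or its opposite has positive real part, so
    [z] is no root. Otherwise [z] is a nonpositive real, and 0 is excluded because the empty
    matching makes the constant coefficient 1. *)
Lemma matching_poly_root (G : multigraph) z :
  root (matching_poly G R[i]) z -> exists2 r : R, 0 < r & z = (- r)%:C.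
Proof.
rewrite /root horner_matching_poly => /eqP Z0.
have sq : sqrtc z ^+ 2 = z by exact: sqr_sqrtc.
have [w0|w0|w0] := ltgtP 0 (complex.Re (sqrtc z)).
- by have [] := @Re_matching_sum_gt0 G _ finset.setT w0; rewrite sq Z0 eqxx.
- have w0' : 0 < complex.Re (- sqrtc z).
    by case: (sqrtc z) w0 => a b /=; rewrite oppr_gt0.
  by have [] := @Re_matching_sum_gt0 G _ finset.setT w0'; rewrite sqrrN sq Z0 eqxx.
- have zE : z = (- (complex.Im (sqrtc z)) ^+ 2)%:C.
    rewrite -[LHS]sq; case: (sqrtc z) w0 => a b /= <-.
    by rewrite expr2; simpc; rewrite expr2.
  exists (complex.Im (sqrtc z) ^+ 2) => //.
  rewrite exprn_even_gt0//=; apply/eqP => b0.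
  move: Z0; rewrite zE b0 expr0n/= oppr0.
  rewrite -horner_matching_poly horner_coef0 coef_poly/=.
  have -> : num_matchings G 0 = 1%N.
    rewrite /num_matchings; apply/eqP/cards1P; exists finset.set0.
    apply/setP => M; rewrite !inE cards_eq0; apply: andb_idl => /eqP ->.
    by apply/is_matchingP => e f; rewrite inE.
  by move/eqP; rewrite oner_eq0.
Qed.

(** Probability generating function of a sum of independent Bernoulli variables with parameters in
    [s]. *)
Definition bernoulli_poly (s : seq R) : {poly R} :=
  \prod_(q <- s) ((1 - q)%:P + q *: 'X).

Lemma bernoulli_poly1 (s : seq R) : (bernoulli_poly s).[1] = 1.
Proof.
rewrite /bernoulli_poly horner_prod big1// => q _.
by rewrite hornerD hornerC hornerZ hornerX mulr1 subrK.
Qed.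

(** A root [-a] with [a > 0] gives [z + a = (1 + a) ((1 - q) + q z)] with [q = 1 / (1 + a)];
    evaluation at 1 identifies the constant. *)
Lemma matching_poly_factor (G : multigraph) :
  exists2 s : seq R, {in s, forall q, 0 <= q <= 1} &
    matching_poly G R = (matching_poly G R).[1] *: bernoulli_poly s.
Proof.
set P := matching_poly G R.
have PE : map_poly (real_complex R) P = matching_poly G R[i].
  apply/polyP => m; rewrite coef_map !coef_poly; case: ifP => _ //=.
  exact: rmorph_nat.
have [r rE] := closed_field_poly_normal (matching_poly G R[i]).
have lead0 : lead_coef (matching_poly G R[i]) != 0.
  rewrite lead_coef_eq0; apply: contraTneq (oner_neq0 R[i]) => P0.
  have [] := @Re_matching_sum_gt0 G 1 finset.setT; first exact: ltr01.
  by rewrite expr1n -horner_matching_poly P0 horner0 eqxx.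
have rP z : z \in r -> exists2 a : R, 0 < a & z = (- a)%:C.
  move=> zr; apply: (@matching_poly_root G).
  by rewrite rE rootZ// root_prod_XsubC.
(* All roots being real, the factorisation over [R[i]] is the image of one over [R], and the
   embedding is injective on polynomials. *)
have PR : P = lead_coef P *: \prod_(z <- r) ('X - (complex.Re z)%:P).
  apply: (@map_poly_inj _ _ (real_complex R)).
  rewrite PE rE map_polyZ/= -lead_coef_map PE; congr (_ *: _).
  rewrite rmorph_prod; apply: eq_big_seq => z /rP[a a0 ->].
  by rewrite rmorphB/= map_polyX map_polyC.
pose q z := (1 - complex.Re z)^-1.
exists [seq q z | z <- r].
  move=> _ /mapP[z /rP[a a0 ->] ->]; rewrite /q /= opprK.
  have a1 : 0 < 1 + a by rewrite addr_gt0.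
  by rewrite invr_ge0 (ltW a1) invf_le1// lerDl ltW.
have QE : \prod_(z <- r) ('X - (complex.Re z)%:P) =
    (\prod_(z <- r) (1 - complex.Re z)) *: bernoulli_poly [seq q z | z <- r].
  rewrite /bernoulli_poly big_map -mul_polyC rmorph_prod -big_split/=.
  apply: eq_big_seq => z /rP[a a0 ->]; rewrite /q /= opprK.
  have a1 : 1 + a != 0 by rewrite gt_eqF// addr_gt0.
  rewrite mulrDr -polyCM -mul_polyC mulrA -polyCM divff// mul1r addrC.
  by congr (_ + _); rewrite mulrBr divff// mulr1 addrAC subrr add0r polyCN opprK.
by rewrite {1}PR QE scalerA {2}PR QE !hornerZ bernoulli_poly1 mulr1.
Qed.

End HeilmannLieb.

(** * Lower bound on the variance of the matching size *)

Section VarianceLowerBound.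
Variables (R : realFieldType) (G : multigraph).
Implicit Types (M : {set edge G}) (e f : edge G).

Let touching e : {set edge G} := [set f | ~~ [disjoint ends e & ends f]].

Lemma degree_le_max (v : vertex G) : (degree v <= max_degree G)%N.
Proof. exact: (@leq_bigmax _ (@degree G)). Qed.

(** [e] lies in the incidence sets of both its ends, so inclusion-exclusion saves one unit, which
    later pays for the diagonal terms. *)
Let card_touching e : (#|touching e|.+1 <= 2 * max_degree G)%N.
Proof.
have /eqP/cards2P[u [v [uv euv]]] := card_ends e.
have -> : touching e = incident_edges u :|: incident_edges v.
  apply/setP => f; rewrite !inE -setI_eq0 euv.
  apply/set0Pn/orP => [[x]|[uf|vf]]; last 2 first.
  - by exists u; rewrite !inE eqxx.
  - by exists v; rewrite !inE eqxx orbT.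
  by rewrite !inE => /andP[/orP[]/eqP->]; [left|right].
have : (#|incident_edges u :&: incident_edges v| > 0)%N.
  by apply/card_gt0P; exists e; rewrite !inE euv !inE !eqxx orbT.
have := cardsUI (incident_edges u) (incident_edges v).
have := degree_le_max u; have := degree_le_max v; rewrite /degree; lia.
Qed.

Let sum_mem (A : {set edge G}) : \sum_f (f \in A)%:R = #|A|%:R :> R.
Proof.
rewrite -sum1_card natr_sum [RHS]big_mkcond/=; apply: eq_bigr => f _.
by case: (f \in A).
Qed.

Let sign e M : R :=
  if e \in M then 1 else if is_matching (e |: M) then -1 else 0.

(** Discrete integration by parts: deleting [e] pairs each matching containing [e], of sign 1, with
    one to which [e] can be added, of sign -1. *)
Let sum_sign e (F : {set edge G} -> R) :
  \sum_(M | is_matching M) sign e M * F M =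
  \sum_(M | is_matching M && (e \in M)) (F M - F (M :\ e)).
Proof.
rewrite (bigID (fun M => e \in M))/= sumrB; congr (_ + _).
  by apply: eq_bigr => M /andP[_ eM]; rewrite /sign eM mul1r.
rewrite [in RHS](reindex_onto (fun M => e |: M) (fun M => M :\ e))/=; last first.
  by move=> M /andP[_ eM]; rewrite finset.setD1K.
rewrite -sumrN big_mkcond [RHS]big_mkcond/=; apply: eq_bigr => M _.
rewrite /sign finset.setU11 andbT; have [eM|eM]/= := boolP (e \in M).
  rewrite andbF; case: andP => // -[_ /eqP MM].
  by move: eM; rewrite -MM !inE eqxx.
rewrite finset.setU1K// eqxx !andbT.
case: (boolP (is_matching (e |: M))) => eMm.
  by rewrite (is_matchingS (finset.subsetUr _ _) eMm) mulN1r.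
by case: ifP; rewrite ?mul0r.
Qed.

Let matching_size : R := \sum_(M : {set edge G} | is_matching M) #|M|%:R.

Let sum_edges (F : {set edge G} -> R) :
  \sum_e \sum_(M | is_matching M && (e \in M)) F M =
  \sum_(M | is_matching M) #|M|%:R * F M.
Proof.
under eq_bigr do rewrite big_mkcondr/=.
rewrite exchange_big/=; apply: eq_bigr => M _.
by rewrite -big_mkcond/= sumr_const mulr_natl.
Qed.

(** Deleting [e] affects the sign of [f] only when [f] touches [e]. For such [f] other than [e] the
    sign goes from 0 to at least -1; for [f = e] it falls from 1 to -1, whence the second
    indicator. *)
Let sum_sign_sub e f M : is_matching M -> e \in M ->
  sign f M - sign f (M :\ e) <= (f \in touching e)%:R + (f == e)%:R.
Proof.
move=> mM eM; have [->|fe] := eqVneq f e.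
  rewrite /sign eM !inE eqxx/= finset.setD1K// mM -setI_eq0 finset.setIid.
  by rewrite -cards_eq0 card_ends/= opprK.
rewrite addr0 /touching inE; have [def|def]/= := boolP [disjoint _ & _]; last first.
  have fM : f \notin M.
    apply/negP => fM; move/is_matchingP: mM => /(_ e f eM fM).
    by rewrite eq_sym fe (negbTE def) => /(_ isT).
  have -> : sign f M = 0.
    rewrite /sign (negbTE fM) ifN//; apply/negP => /is_matchingP/(_ e f).
    by rewrite !inE eM eqxx orbT eq_sym fe (negbTE def) => /(_ isT isT isT).
  rewrite /sign !inE (negbTE fM) andbF/=; case: ifP => _; lra.
rewrite /sign !inE fe/=; case: ifP => // fM; first by rewrite subrr.
suff -> : is_matching (f |: M) = is_matching (f |: M :\ e) by rewrite subrr.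
apply/idP/idP; first by apply: is_matchingS; apply/finset.setUS/subD1set.
move=> /is_matchingP mfM; apply/is_matchingP => g h.
have dis g' : g' \in M -> [disjoint ends f & ends g'].
  move=> gM; have [->|ge] := eqVneq g' e; first by rewrite disjoint_sym.
  apply: mfM; rewrite ?inE ?eqxx ?ge ?gM ?orbT//.
  by apply: contraFneq fM => ->.
rewrite !inE => /predU1P[->|gM] /predU1P[->|hM]; first by rewrite eqxx.
- by move=> _; exact: dis.
- by move=> _; rewrite disjoint_sym; exact: dis.
- by move/is_matchingP: mM; exact.
Qed.

Let total_sign M := \sum_e sign e M.

(** Integration by parts in one factor leaves [total_sign M - total_sign (M :\ e)] for each [e] in
    [M], which is at most [#|touching e| + 1]. *)
Let sum_total_sign_sqr :
  \sum_(M | is_matching M) total_sign M ^+ 2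
    <= 2 * (max_degree G)%:R * matching_size.
Proof.
under eq_bigr => M _ do rewrite expr2 {1}/total_sign mulr_suml.
rewrite exchange_big/=; under eq_bigr do rewrite sum_sign.
rewrite /matching_size mulr_sumr.
under [leRHS]eq_bigr do rewrite mulrC.
rewrite -sum_edges; apply: ler_sum => e _; apply: ler_sum => M /andP[mM eM].
rewrite /total_sign -sumrB.
apply: (le_trans (ler_sum _ (fun f _ => sum_sign_sub f mM eM))).
rewrite big_split/= sum_mem.
rewrite (bigD1 e)//= eqxx big1 ?addr0; last by move=> f /negbTE ->.
by rewrite -natrM natr1 ler_nat card_touching.
Qed.

(** Every edge touches an edge of [M] or can be added to [M]. Over all matchings the signs cancel,
    and each edge of [M] is charged for the edges touching it plus one. *)
Let card_edge_le :
  #|edge G|%:R * (\sum_(M : {set edge G} | is_matching M) 1) <=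
  2 * (max_degree G)%:R * matching_size.
Proof.
(* If [e] is in [M] it touches itself; if it can be added, [- sign e M] is 1; otherwise some edge of
   [M] touches it. *)
have cover e M : is_matching M ->
    1 <= \sum_(f in M) (e \in touching f)%:R + ((e \in M)%:R - sign e M).
  move=> mM.
  have ge0 : 0 <= \sum_(f in M) (e \in touching f)%:R :> R.
    by apply: sumr_ge0 => f _; rewrite ler0n.
  rewrite /sign; case: ifP => eM.
    rewrite (bigD1 e)//= inE -setI_eq0 finset.setIid -cards_eq0 card_ends/=.
    by rewrite subrr addr0 lerDl; apply: sumr_ge0 => f _; rewrite ler0n.
  case: ifPn => meM; first by rewrite /=; lra.
  rewrite subrr addr0.
  have [/exists_inP[f fM fe]|] := boolP [exists f in M, e \in touching f].
    by rewrite (bigD1 f)//= fe lerDl; apply: sumr_ge0 => ? _; rewrite ler0n.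
  rewrite negb_exists_in => /forall_inP dis; case/negP: meM.
  have disj f : f \in M -> [disjoint ends f & ends e].
    by move=> /dis; rewrite inE negbK.
  apply/is_matchingP => f g; rewrite !inE => /predU1P[->|fM] /predU1P[->|gM].
  - by rewrite eqxx.
  - by move=> _; rewrite disjoint_sym; exact: disj.
  - by move=> _; exact: disj.
  - by move/is_matchingP: mM; exact.
rewrite mulr_sumr mulr1.
have -> : \sum_(M : {set edge G} | is_matching M) #|edge G|%:R =
    \sum_(M : {set edge G} | is_matching M) \sum_(e : edge G) 1 :> R.
  by apply: eq_bigr => M _; rewrite sumr_const.
apply: (@le_trans _ _ (\sum_(M : {set edge G} | is_matching M) \sum_(e : edge G)
   (\sum_(f in M) (e \in touching f)%:R + ((e \in M)%:R - sign e M)))).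
  by apply: ler_sum => M mM; apply: ler_sum => e _; exact: cover.
under eq_bigr do rewrite big_split/= sumrB.
rewrite big_split sumrB/=.
(* Integration by parts against the constant 1. *)
have -> : \sum_(M : {set edge G} | is_matching M) \sum_e sign e M = 0.
  rewrite exchange_big/= big1// => e _.
  have := sum_sign e (fun=> 1); rewrite [RHS]big1; last by move=> M _; rewrite subrr.
  by rewrite -mulr_suml mulr1.
rewrite subr0 -big_split/= /matching_size mulr_sumr; apply: ler_sum => M _.
rewrite exchange_big/=.
have cardM : #|M|%:R = \sum_(f in M) 1 :> R by rewrite sumr_const.
rewrite sum_mem cardM mulr_sumr -big_split/=.
apply: ler_sum => f _.
by rewrite sum_mem mulr1 -natrM natr1 ler_nat card_touching.
Qed.

(* Cauchy-Schwarz against the statistic [total_sign], i.e. expanding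
   [(|M| - mu - total_sign M / 2d)^2 >= 0]. *)
Lemma sum_matching_sqr_ge (mu : R) : (0 < max_degree G)%N ->
  #|edge G|%:R / (4 * (max_degree G)%:R ^+ 2) *
    (\sum_(M : {set edge G} | is_matching M) 1) <=
  \sum_(M : {set edge G} | is_matching M) (#|M|%:R - mu) ^+ 2.
Proof.
move=> d0; set d : R := (max_degree G)%:R.
have dp : 0 < d by rewrite ltr0n.
(* With cross term [A] and second moment at most [2 d A], where [A] is [matching_size], this [c]
   minimises [c^2 (2 d A) - 2 c A]. *)
set c := (2 * d)^-1.
have c0 : 0 < c by rewrite invr_gt0 mulr_gt0.
(* Integration by parts applied to [#|M| - mu], which drops by exactly 1 when an edge is deleted;
   [mu] cancels. *)
have cross : \sum_(M | is_matching M) (#|M|%:R - mu) * total_sign M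
    = matching_size.
  under eq_bigr do rewrite mulrC /total_sign mulr_suml.
  rewrite exchange_big/=; under eq_bigr do rewrite sum_sign.
  rewrite [in RHS]/matching_size; under [RHS]eq_bigr do rewrite -[_%:R]mulr1.
  rewrite -sum_edges; apply: eq_bigr => e _; apply: eq_bigr => M /andP[_ eM].
  by rewrite (cardsD1 e M) eM natrD opprB addrA subrK addrK.
have : 0 <= \sum_(M | is_matching M)
    (#|M|%:R - mu - c * total_sign M) ^+ 2.
  by apply: sumr_ge0 => M _; exact: sqr_ge0.
have -> : \sum_(M | is_matching M) (#|M|%:R - mu - c * total_sign M) ^+ 2 =
    \sum_(M : {set edge G} | is_matching M) (#|M|%:R - mu) ^+ 2
    - 2 * c * matching_size
    + c ^+ 2 * \sum_(M | is_matching M) total_sign M ^+ 2.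
  rewrite -cross !mulr_sumr -sumrB -big_split/=; apply: eq_bigr => M _; ring.
have := card_edge_le; have := sum_total_sign_sqr; rewrite -/d.
set S := \sum_(M | _) (_ - _) ^+ 2; set T := \sum_(M | _) _ ^+ 2.
set N := \sum_(M | _) 1; set E := #|edge G|%:R; set A := matching_size.
move=> TA EA pos.
have -> : E / (4 * d ^+ 2) * N = c ^+ 2 * (E * N).
  by rewrite /c; field; rewrite gt_eqF.
have c2 : 0 <= c ^+ 2 by exact: sqr_ge0.
have h1 := ler_wpM2l c2 TA; have h2 := ler_wpM2l c2 EA.
have e1 : c ^+ 2 * (2 * d * A) = c * A.
  by rewrite /c; field; rewrite gt_eqF.
by rewrite e1 in h1 h2; lra.
Qed.

End VarianceLowerBound.

Local Open Scope classical_set_scope.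
Local Open Scope ring_scope.

(** * Elementary bounds on sine, cosine and the exponential *)

Section Calculus.
Variable R : realType.
Implicit Types (a b c t x y : R) (f g : R -> R).

(** Mean value theorem on [0, x]. Each Taylor bound below follows by differentiating once and using
    the previous one. *)
Lemma ge0_of_derive_ge0 f df :
  (forall x, is_derive x 1 f (df x)) -> f 0 = 0 ->
  (forall x, 0 <= x -> 0 <= df x) -> forall x, 0 <= x -> 0 <= f x.
Proof.
move=> fdf f0 df0 x x0.
have cf : {within `[0, x], continuous f}.
  by apply: derivable_within_continuous => y _; exact: ex_derive.
have [c c0x] := MVT_segment x0 (fun y _ => fdf y) cf.
rewrite f0 !subr0 => ->; rewrite mulr_ge0// df0//.
by move: c0x; rewrite in_itv => /andP[].
Qed.

Lemma sin_le_id x : 0 <= x -> sin x <= x.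
Proof.
move=> x0; rewrite -subr_ge0; move: x x0.
apply: (@ge0_of_derive_ge0 _ (fun x => 1 - cos x)) => [|x _].
- by rewrite sin0 subr0.
- by rewrite subr_ge0 cos_le1.
Qed.

Lemma cos_ge_sqr x : 0 <= x -> 1 - x ^+ 2 / 2 <= cos x.
Proof.
move=> x0; rewrite -subr_ge0; move: x x0.
apply: (@ge0_of_derive_ge0 _ (fun x => x - sin x)) => [x||x x0].
- by apply: is_derive_eq; rewrite /GRing.scale/=; field.
- by rewrite cos0; ring.
- by rewrite subr_ge0 sin_le_id.
Qed.

Lemma sin_ge_cube x : 0 <= x -> x - x ^+ 3 / 6 <= sin x.
Proof.
move=> x0; rewrite -subr_ge0; move: x x0.
apply: (@ge0_of_derive_ge0 _ (fun x => cos x - (1 - x ^+ 2 / 2))) => [x||x x0].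
- by apply: is_derive_eq; rewrite /GRing.scale/=; field.
- by rewrite sin0; ring.
- by rewrite subr_ge0 cos_ge_sqr.
Qed.

Lemma cos_le_quartic x : 0 <= x -> cos x <= 1 - x ^+ 2 / 2 + x ^+ 4 / 24.
Proof.
move=> x0; rewrite -subr_ge0; move: x x0.
apply: (@ge0_of_derive_ge0 _ (fun x => sin x - (x - x ^+ 3 / 6))) => [x||x x0].
- by apply: is_derive_eq; rewrite /GRing.scale/=; field.
- by rewrite cos0; ring.
- by rewrite subr_ge0 sin_ge_cube.
Qed.

Lemma expRN_le_sqr x : 0 <= x -> expR (- x) <= 1 - x + x ^+ 2 / 2.
Proof.
move=> x0; rewrite -subr_ge0; move: x x0.
apply: (@ge0_of_derive_ge0 _ (fun x => expR (- x) - (1 - x))) => [x||x x0].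
- by apply: is_derive_eq; rewrite /GRing.scale/=; field.
- by rewrite oppr0 expR0; ring.
- by rewrite subr_ge0 expR_ge1Dx.
Qed.

(* Weaker than Jordan's [2x/pi <= sin x], as only [pi < 4] is at hand. *)
Lemma sin_ge_half x : 0 <= x <= pi / 2 -> x / 2 <= sin x.
Proof.
move=> /andP[x0 xpi].
have csin a b : {within `[a, b], continuous (@sin R)}.
  by apply: continuous_subspaceT => y; exact: continuous_sin.
have [a] := MVT_segment x0 (fun y _ => is_derive_sin y) (@csin 0 x).
have [b] := MVT_segment xpi (fun y _ => is_derive_sin y) (@csin x (pi / 2)).
rewrite sin0 sin_pihalf !subr0 !in_itv/= => /andP[xb bpi] sb /andP[a0 ax] sa.
have pi4 := pihalf_lt2 R; have pi1 := pihalf_ge1 R.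
have cab : cos b <= cos a.
  have aI : a \in `[0, pi] by rewrite in_itv/= a0/=; lra.
  have bI : b \in `[0, pi] by rewrite in_itv/= (le_trans x0 xb)/=; lra.
  by rewrite leNgt ltr_cos// -leNgt (le_trans ax xb).
(* If [sin x < x / 2], the slope [cos a] is below 1/2, hence so is [cos b], and the sine at [pi / 2]
   would be below [pi / 4 < 1]. *)
rewrite sa leNgt; apply/negP => lt_sin.
have ca : cos a < 1 / 2.
  rewrite ltNge; apply/negP => ca.
  have := ler_wpM2r x0 ca; lra.
have : cos b * (pi / 2 - x) <= 1 / 2 * (pi / 2 - x).
  by rewrite ler_wpM2r ?subr_ge0//; lra.
lra.
Qed.

(** Half-angle formula [1 - cos t = 2 sin^2 (t / 2)], with the linear lower bound on the sine; it
    covers all of [0, pi]. *)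
Lemma cos_le_sqr t : 0 <= t <= pi -> cos t <= 1 - t ^+ 2 / 8.
Proof.
move=> /andP[t0 tpi].
have h : t / 4 <= sin (t / 2).
  rewrite (_ : t / 4 = t / 2 / 2); last by field.
  by apply: sin_ge_half; rewrite ?divr_ge0 ?ler_pM2r.
have -> : t = (t / 2) *+ 2 by rewrite -mulr_natr; field.
rewrite cos_mulr2n cos2sin2 -[X in X - 1]mulr_natr.
have -> : ((t / 2) *+ 2) ^+ 2 / 8 = 2 * (t / 4) ^+ 2.
  by rewrite -mulr_natr; field.
suff : (t / 4) ^+ 2 <= sin (t / 2) ^+ 2 by lra.
by rewrite ler_sqr ?nnegrE ?divr_ge0 // (le_trans _ h) ?divr_ge0.
Qed.

(** The product whose derivative provides the integration by parts for the Gaussian cosine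
    transform. *)
Lemma is_derive_gauss_sin a c t :
  is_derive t 1 (fun t => expR (- (a * t ^+ 2 / 2)) * sin (c * t))
    (c * (expR (- (a * t ^+ 2 / 2)) * cos (c * t)) -
     a * (t * expR (- (a * t ^+ 2 / 2)) * sin (c * t))).
Proof.
by apply: is_derive_eq; rewrite /GRing.scale/=; field.
Qed.

End Calculus.

(** * Characteristic functions of Bernoulli sums compared with the Gaussian *)

Section CharacteristicFunction.
Import Normc.
Local Open Scope complex_scope.
Variable R : realType.
Implicit Types (q t x y v : R) (s : seq R) (z : R[i]).

Definition cis x : R[i] := cos x +i* sin x.

Lemma cisD x y : cis (x + y) = cis x * cis y.
Proof. by apply/eqP; rewrite eq_complex/= cosD sinD eqxx addrC eqxx. Qed.

Lemma cis0 : cis 0 = 1.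
Proof. by rewrite /cis cos0 sin0. Qed.

Lemma normc_cis x : normc (cis x) = 1.
Proof. by rewrite /= cos2Dsin2 sqrtr1. Qed.

Lemma cisX x k : cis x ^+ k = cis (k%:R * x).
Proof.
elim: k => [|k IH]; first by rewrite mul0r cis0.
by rewrite exprS IH -cisD -natr1 mulrDl mul1r addrC.
Qed.

Lemma ge0_normc z : 0 <= normc z.
Proof. by case: z => a b /=; exact: sqrtr_ge0. Qed.

Lemma normc_ReIm_le z : normc z <= `|complex.Re z| + `|complex.Im z|.
Proof.
case: z => a b /=; rewrite -(@ler_sqr R) ?nnegrE ?sqrtr_ge0 ?addr_ge0//.
rewrite sqr_sqrtr ?addr_ge0 ?sqr_ge0// sqrrD !real_normK ?num_real//.
by rewrite addrAC lerDl mulrn_wge0 ?mulr_ge0.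
Qed.

Lemma Re_le_normc z : `|complex.Re z| <= normc z.
Proof.
case: z => a b /=; rewrite -sqrtr_sqr ler_wsqrtr// lerDl; exact: sqr_ge0.
Qed.

(* Centred: the last factor subtracts the mean [q]. *)
Definition bernoulli_char q t : R[i] :=
  ((1 - q)%:C + q%:C * cis t) * cis (- (q * t)).

Lemma bernoulli_charE q t : bernoulli_char q t =
  ((1 - q) * cos (q * t) + q * cos ((1 - q) * t)) +i*
  (q * sin ((1 - q) * t) - (1 - q) * sin (q * t)).
Proof.
have -> : bernoulli_char q t = (1 - q)%:C * cis (- (q * t)) +
                               q%:C * cis ((1 - q) * t).
  rewrite /bernoulli_char mulrDl -mulrA -cisD; congr (_ + _ * cis _); ring.
by rewrite /cis cosN sinN; simpc; congr (_ +i* _); ring.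
Qed.

Lemma variance_le_quarter q : q * (1 - q) <= 4^-1.
Proof. by have := sqr_ge0 (q - 1 / 2); lra. Qed.

(** The squared modulus is [1 - 2 q (1 - q) (1 - cos t)]; the quadratic bound on the cosine and
    [1 - y <= exp (- y)] conclude. *)
Lemma normc_bernoulli_char q t : 0 <= q <= 1 -> 0 <= t <= pi ->
  normc (bernoulli_char q t) <= expR (- (q * (1 - q) * t ^+ 2 / 8)).
Proof.
move=> /andP[q0 q1] t0pi; rewrite /bernoulli_char normcM normc_cis mulr1.
have v0 : 0 <= q * (1 - q) by rewrite mulr_ge0 ?subr_ge0.
rewrite /cis; simpc => /=.
rewrite -(@ler_sqr R) ?nnegrE ?sqrtr_ge0 ?expR_ge0//.
rewrite sqr_sqrtr ?addr_ge0 ?sqr_ge0//.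
have -> : (1 - q + q * cos t) ^+ 2 + (q * sin t) ^+ 2 =
          1 - 2 * (q * (1 - q)) * (1 - cos t).
  by rewrite exprMn sin2cos2; ring.
rewrite -expRM_natr (le_trans _ (expR_ge1Dx _))//.
have := ler_wpM2l v0 (cos_le_sqr t0pi); lra.
Qed.

(** Centring cancels the first-order terms and the variances match the second-order ones. The real
    and imaginary parts then contribute at most [v t^3 / 6] each, where [v = q (1 - q)]. *)
Lemma normc_bernoulli_char_sub q t : 0 <= q <= 1 -> 0 <= t <= pi ->
  normc (bernoulli_char q t - (expR (- (q * (1 - q) * t ^+ 2 / 2)))%:C)
    <= q * (1 - q) * t ^+ 3 / 3.
Proof.
move=> /andP[q0 q1] /andP[t0 tpi].
have t4 : t <= 4 by have := pihalf_lt2 R; lra.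
have p0 : 0 <= 1 - q by rewrite subr_ge0.
have p1 : 1 - q <= 1 by lra.
have v0 : 0 <= q * (1 - q) by rewrite mulr_ge0.
apply: (le_trans (normc_ReIm_le _)).
rewrite bernoulli_charE /= subr0.
set v := q * (1 - q) in v0 *; set p := 1 - q in p0 p1 v v0 *.
have qt : 0 <= q * t by rewrite mulr_ge0.
have pt : 0 <= p * t by rewrite mulr_ge0.
have t3 : 0 <= t ^+ 3 by rewrite exprn_ge0.
(* Since [t <= pi < 4], quartic remainders are absorbed into cubic ones. *)
have t34 : t ^+ 4 <= 4 * t ^+ 3 by rewrite exprS ler_wpM2r.
have vt3 : 0 <= v * t ^+ 3 by rewrite mulr_ge0.
have q2 : 0 <= q ^+ 2 <= 1 by rewrite exprn_ge0// exprn_ile1.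
have p2 : 0 <= p ^+ 2 <= 1 by rewrite exprn_ge0// exprn_ile1.
have Cl := cos_ge_sqr qt. have Cl' := cos_ge_sqr pt.
have Cu := cos_le_quartic qt. have Cu' := cos_le_quartic pt.
have Sl := sin_ge_cube qt. have Sl' := sin_ge_cube pt.
have Su := sin_le_id qt. have Su' := sin_le_id pt.
have y0 : 0 <= v * t ^+ 2 / 2 by rewrite divr_ge0// mulr_ge0// sqr_ge0.
have El := expR_ge1Dx (- (v * t ^+ 2 / 2)).
have Eu := expRN_le_sqr y0.
have pq : p + q = 1 by rewrite /p subrK.
have vE : v = q * p by [].
(* The left side equals [v (1 - 3 v)], because [p + q = 1]. *)
have q4p4 : p * q ^+ 4 + q * p ^+ 4 <= v.
  have -> : p * q ^+ 4 + q * p ^+ 4 = v * (q ^+ 3 + p ^+ 3) by rewrite vE; ring.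
  rewrite -[leRHS]mulr1 ler_wpM2l//.
  have -> : q ^+ 3 + p ^+ 3 = 1 - 3 * v by rewrite vE /p; ring.
  lra.
(* This lets the second-order term of the exponential fit under the same [v t^4 / 24] as the
   cosines. *)
have v4 : v ^+ 2 <= v / 4.
  by rewrite expr2 ler_wpM2l// variance_le_quarter.
have t4_0 : 0 <= t ^+ 4 by rewrite exprn_ge0.
have C0l : 1 - v * t ^+ 2 / 2 <= p * cos (q * t) + q * cos (p * t).
  have := lerD (ler_wpM2l p0 Cl) (ler_wpM2l q0 Cl').
  apply: le_trans; rewrite le_eqVlt; apply/orP; left; apply/eqP.
  by rewrite vE /p; field.
have C0u : p * cos (q * t) + q * cos (p * t) <=
    1 - v * t ^+ 2 / 2 + v * t ^+ 4 / 24.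
  apply: (le_trans (lerD (ler_wpM2l p0 Cu) (ler_wpM2l q0 Cu'))).
  have -> : p * (1 - (q * t) ^+ 2 / 2 + (q * t) ^+ 4 / 24) +
            q * (1 - (p * t) ^+ 2 / 2 + (p * t) ^+ 4 / 24) =
      1 - v * t ^+ 2 / 2 + (p * q ^+ 4 + q * p ^+ 4) * t ^+ 4 / 24.
    by rewrite vE /p; field.
  by rewrite lerD2l ler_wpM2r// ler_wpM2r.
have E0u : expR (- (v * t ^+ 2 / 2)) <= 1 - v * t ^+ 2 / 2 + v * t ^+ 4 / 24.
  apply: (le_trans Eu); rewrite lerD2l.
  have := ler_wpM2r t4_0 v4.
  have -> : (v * t ^+ 2 / 2) ^+ 2 / 2 = v ^+ 2 * t ^+ 4 / 8 by field.
  have := mulr_ge0 v0 t4_0; lra.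
have vt4 : v * t ^+ 4 / 24 <= v * t ^+ 3 / 6.
  by have := ler_wpM2l v0 t34; lra.
have I0u : q * sin (p * t) - p * sin (q * t) <= v * t ^+ 3 / 6.
  have := lerB (ler_wpM2l q0 Su') (ler_wpM2l p0 Sl).
  have -> : q * (p * t) - p * (q * t - (q * t) ^+ 3 / 6) =
     v * t ^+ 3 * q ^+ 2 / 6 by rewrite vE; field.
  by have /andP[_ h] := q2; have := ler_wpM2l vt3 h; lra.
have I0l : - (v * t ^+ 3 / 6) <= q * sin (p * t) - p * sin (q * t).
  have := lerB (ler_wpM2l q0 Sl') (ler_wpM2l p0 Su).
  have -> : q * (p * t - (p * t) ^+ 3 / 6) - p * (q * t) =
     - (v * t ^+ 3 * p ^+ 2 / 6) by rewrite vE; field.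
  by have /andP[_ h] := p2; have := ler_wpM2l vt3 h; lra.
have -> : v * t ^+ 3 / 3 = v * t ^+ 3 / 6 + v * t ^+ 3 / 6 by field.
by apply: lerD; rewrite ler_norml; lra.
Qed.

Definition bernoulli_variance s : R := \sum_(q <- s) q * (1 - q).

Lemma bernoulli_variance_ge0 s :
  {in s, forall q, 0 <= q <= 1} -> 0 <= bernoulli_variance s.
Proof.
move=> s01; rewrite /bernoulli_variance big_seq; apply: sumr_ge0 => q /s01.
by move=> /andP[q0 q1]; rewrite mulr_ge0 ?subr_ge0.
Qed.

(** Telescoping through [a A - b B = (a - b) A + b (A - B)]. The modulus bound controls [A] there,
    so both bounds share one induction. *)
Lemma normc_prod_bernoulli_char s t :
  {in s, forall q, 0 <= q <= 1} -> 0 <= t <= pi ->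
  normc (\prod_(q <- s) bernoulli_char q t)
    <= expR (- (bernoulli_variance s * t ^+ 2 / 8)) /\
  normc (\prod_(q <- s) bernoulli_char q t
         - (expR (- (bernoulli_variance s * t ^+ 2 / 2)))%:C)
    <= 2 / 3 * bernoulli_variance s * t ^+ 3
       * expR (- (bernoulli_variance s * t ^+ 2 / 8)).
Proof.
move=> s01 t0pi; elim: s s01 => [|q s IH] s01.
  rewrite /bernoulli_variance !big_nil !mul0r oppr0 expR0 subrr.
  by rewrite normc1 normc0 mulr0 !mul0r.
have q01 : 0 <= q <= 1 by apply: s01; rewrite mem_head.
have /IH[IH1 IH2] : {in s, forall q, 0 <= q <= 1}.
  by move=> x xs; apply: s01; rewrite inE xs orbT.
have V0 : 0 <= bernoulli_variance s.
  by apply: bernoulli_variance_ge0 => x xs; apply: s01; rewrite inE xs orbT.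
have -> : bernoulli_variance (q :: s) = q * (1 - q) + bernoulli_variance s.
  by rewrite /bernoulli_variance big_cons.
rewrite big_cons.
have a1 := normc_bernoulli_char q01 t0pi.
have a2 := normc_bernoulli_char_sub q01 t0pi.
have v4 := variance_le_quarter q.
have v0 : 0 <= q * (1 - q) by case/andP: q01 => q0 q1; rewrite mulr_ge0 ?subr_ge0.
move: a1 a2 v4 v0 IH1 IH2 V0.
set a := bernoulli_char q t; set A := \prod_(j <- s) _; set v := q * (1 - q).
set V := bernoulli_variance s => a1 a2 v4 v0 A1 A2 V0.
have t0 : 0 <= t by case/andP: t0pi.
have t16 : t ^+ 2 <= 16.
  have -> : 16 = 4 ^+ 2 :> R by ring.
  by rewrite ler_sqr ?nnegrE//; have := pihalf_lt2 R; case/andP: t0pi; lra.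
have expD c : expR (- ((v + V) * t ^+ 2 / c)) =
    expR (- (v * t ^+ 2 / c)) * expR (- (V * t ^+ 2 / c)).
  by rewrite -expRD; congr expR; ring.
rewrite !expD; split; first by rewrite normcM ler_pM ?ge0_normc.
set b := expR (- (v * _ / 2)) in a2 *; set B := expR (- (V * _ / 2)) in A2 *.
set c := expR (- (v * _ / 8)) in a1 *; set C := expR (- (V * _ / 8)) in A1 A2 *.
have -> : a * A - (b * B)%:C = (a - b%:C) * A + b%:C * (A - B%:C).
  by rewrite rmorphM/=; ring.
apply: (le_trans (le_normcD _ _)); rewrite !normcM.
have nb : normc b%:C = b.
  by rewrite /= expr0n/= addr0 sqrtr_sqr ger0_norm ?expR_ge0.
have bc : b <= c by rewrite ler_expR; have := mulr_ge0 v0 (sqr_ge0 t); lra.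
(* As [v <= 1/4] and [t^2 <= 16], the exponent is at most 1/2. Then [1/3 <= (2/3) c], so the new
   term can carry the full decay [c C]; this is why 1/3 becomes 2/3. *)
have c2 : 1 / 2 <= c.
  apply: le_trans (expR_ge1Dx _).
  by have := ler_pM v0 (sqr_ge0 t) v4 t16; lra.
have C0 : 0 <= C by exact: expR_ge0.
have t3 : 0 <= t ^+ 3 by rewrite exprn_ge0.
have h1 : normc (a - b%:C) * normc A <= v * t ^+ 3 / 3 * C.
  by rewrite ler_pM ?ge0_normc.
have h2 : normc b%:C * normc (A - B%:C) <= c * (2 / 3 * V * t ^+ 3 * C).
  by rewrite ler_pM ?ge0_normc// nb.
apply: (le_trans (lerD h1 h2)).
have -> : 2 / 3 * (v + V) * t ^+ 3 * (c * C) =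
  v * t ^+ 3 * C * (2 / 3 * c) + c * (2 / 3 * V * t ^+ 3 * C) by ring.
rewrite lerD2r (_ : v * t ^+ 3 / 3 * C = v * t ^+ 3 * C * (1 / 3)); last by field.
by rewrite ler_wpM2l ?mulr_ge0//; lra.
Qed.

Definition bernoulli_mean s : R := \sum_(q <- s) q.

(** Multiplication by a unit complex number moves the centre from the mean to [x], and taking real
    parts does not increase the modulus. *)
Lemma char_sub_gauss_le s t x :
  {in s, forall q, 0 <= q <= 1} -> 0 <= t <= pi ->
  `| \sum_(k < size (bernoulli_poly s))
        (bernoulli_poly s)`_k * cos ((k%:R - x) * t)
     - expR (- (bernoulli_variance s * t ^+ 2 / 2))
       * cos ((x - bernoulli_mean s) * t) |
  <= 2 / 3 * bernoulli_variance s * t ^+ 3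
     * expR (- (bernoulli_variance s * t ^+ 2 / 8)).
Proof.
move=> s01 t0pi; have [_] := normc_prod_bernoulli_char s01 t0pi.
apply: le_trans; set A := \prod_(q <- s) _; set B := expR _.
set mu := bernoulli_mean s; set P := bernoulli_poly s.
have AE : A = (map_poly (real_complex R) P).[cis t] * cis (- (mu * t)).
  rewrite /A /P /bernoulli_poly rmorph_prod horner_prod /mu /bernoulli_mean.
  rewrite mulr_suml -sumrN.
  have -> : cis (\sum_(q <- s) - (q * t)) = \prod_(q <- s) cis (- (q * t)).
    by apply: (big_morph _ cisD cis0).
  rewrite -big_split/=; apply: eq_bigr => q _; congr (_ * _).
  rewrite [in RHS]rmorphD/= map_polyC map_polyZ map_polyX.
  by rewrite hornerD hornerC hornerZ hornerX.
have sumE : \sum_(k < size P) P`_k * cos ((k%:R - x) * t) =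
    complex.Re ((map_poly (real_complex R) P).[cis t] * cis (- (x * t))).
  rewrite horner_coef size_map_poly mulr_suml.
  have ReD : {morph @complex.Re R : y z / y + z >-> y + z}.
    by move=> [? ?] [? ?].
  rewrite (big_morph _ ReD (erefl (complex.Re 0)))/=.
  apply: eq_bigr => k _; rewrite coef_map/= cisX -mulrA -cisD -mulrBl.
  by rewrite /cis; simpc.
have -> : \sum_(k < size P) P`_k * cos ((k%:R - x) * t) - B * cos ((x - mu) * t)
    = complex.Re ((A - B%:C) * cis ((mu - x) * t)).
  rewrite sumE [(A - _) * _]mulrBl {1}AE -[_ * cis _ * cis _]mulrA -cisD.
  rewrite (_ : - (mu * t) + _ = - (x * t)); last by ring.
  have -> : cos ((x - mu) * t) = cos ((mu - x) * t).
    by rewrite -cosN; congr cos; ring.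
  rewrite /cis.
  by case: (_ * _) => ? ? /=; rewrite mul0r subr0.
by apply: (le_trans (Re_le_normc _)); rewrite normcM normc_cis mulr1.
Qed.

End CharacteristicFunction.

(** * Integrals over segments: Fourier inversion and Gaussian bounds *)

Section Integrals.
Variable R : realType.
Implicit Types (a b c t x y V : R) (f F : R -> R).
Local Notation mu := (@lebesgue_measure R).

Lemma derivable_continuous f : (forall x, derivable f x 1) -> continuous f.
Proof.
by move=> df x; apply/differentiable_continuous/derivable1_diffP/df.
Qed.

Lemma continuous_integrable f a b :
  continuous f -> mu.-integrable `[a, b] (EFin \o f).
Proof.
move=> cf; apply: continuous_compact_integrable; first exact: segment_compact.
exact: continuous_subspaceT.
Qed.

Lemma Rintegral_FTC F f a b : a < b ->
  (forall x, is_derive x 1 F (f x)) -> continuous f ->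
  \int[mu]_(x in `[a, b]) f x = F b - F a.
Proof.
move=> ab dF cf; rewrite /Rintegral (@continuous_FTC2 _ f F)//=.
- exact: continuous_subspaceT.
- have cF : continuous F by apply: derivable_continuous => x; exact: ex_derive.
  split=> [x _||]; first exact: ex_derive.
  + exact/cvg_at_right_filter/cF.
  + exact/cvg_at_left_filter/cF.
- by move=> x _; rewrite derive1E derive_val.
Qed.

Lemma sin_int_pi (m : int) : sin (m%:~R * pi) = 0 :> R.
Proof.
have nat_case (n : nat) : sin (n%:R * pi) = 0 :> R.
  elim: n => [|n IH]; first by rewrite mul0r sin0.
  by rewrite -natr1 mulrDl mul1r sinDpi IH oppr0.
case: m => n; first exact: nat_case.
by rewrite NegzE mulrNz mulNr sinN -pmulrn nat_case oppr0.
Qed.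

(* Fourier inversion for laws on the integers. *)
Lemma Rintegral_cos_sum n (p : nat -> R) (m : int) :
  \int[mu]_(t in `[0, pi])
    (\sum_(k < n) p k * cos ((k%:R - m%:~R) * t)) =
  pi * \sum_(k < n | k%:Z == m) p k.
Proof.
(* Termwise primitive: for [k = m] the cosine is constantly 1, otherwise the sine vanishes at both 0
   and [pi]. *)
pose h (k : 'I_n) : R -> R := fun t => p k *
  (if k%:Z == m then t else sin ((k%:R - m%:~R) * t) / (k%:R - m%:~R)).
have dh t k : is_derive t 1 (h k) (p k * cos ((k%:R - m%:~R) * t)).
  rewrite /h; case: eqVneq => [<-|km].
    apply: is_derive_eq; rewrite -pmulrn subrr mul0r cos0 /GRing.scale/=; ring.
  have km0 : k%:R - m%:~R != 0 :> R.
    by rewrite pmulrn -intrB intr_eq0 subr_eq0.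
  by apply: is_derive_eq; rewrite /GRing.scale/=; field.
rewrite (@Rintegral_FTC (\sum_(k < n) h k)) ?pi_gt0//.
- rewrite !fct_sumE -sumrB mulr_sumr [RHS]big_mkcond/=; apply: eq_bigr => k _.
  rewrite /h; case: eqVneq => [_|km]; first by ring.
  rewrite pmulrn -intrB sin_int_pi !mulr0 sin0.
  by rewrite !mul0r !mulr0 subrr.
- apply: derivable_continuous => t.
  have -> : (fun t => \sum_(k < n) p k * cos ((k%:R - m%:~R) * t)) =
      \sum_(k < n) (fun t => p k * cos ((k%:R - m%:~R) * t)).
    by apply/funext => u; rewrite fct_sumE.
  by apply: derivable_sum => k; exact: ex_derive.
Qed.

(** The explicit primitive is [- 32 / V^2] at 0 and nonpositive at [pi]. *)
Lemma Rintegral_cube_gauss_le V : 0 < V ->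
  \int[mu]_(t in `[0, pi]) (t ^+ 3 * expR (- (V * t ^+ 2 / 8))) <= 32 / V ^+ 2.
Proof.
move=> V0.
pose F t := - (4 * t ^+ 2 / V + 32 / V ^+ 2) * expR (- (V * t ^+ 2 / 8)).
have dF t : is_derive t 1 F (t ^+ 3 * expR (- (V * t ^+ 2 / 8))).
  rewrite /F; apply: is_derive_eq; rewrite /GRing.scale/=.
  by field; rewrite gt_eqF.
rewrite (Rintegral_FTC (pi_gt0 R) dF).
- have -> : F 0 = - (32 / V ^+ 2).
    by rewrite /F expr0n/= !(mulr0, mul0r, oppr0, expR0, mulr1, add0r).
  rewrite opprK gerDr /F mulNr oppr_le0 mulr_ge0 ?expR_ge0// addr_ge0//.
    by rewrite divr_ge0 ?(ltW V0)// mulr_ge0 ?sqr_ge0.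
  by rewrite divr_ge0 ?sqr_ge0.
- by apply: derivable_continuous => t; exact: ex_derive.
Qed.

(** On this range [t >= 1], so an extra factor [t] only increases the integrand and makes its
    primitive explicit. The bound is uniform in [b]. *)
Lemma Rintegral_gauss_tail_le V b : 0 < V -> pi < b ->
  \int[mu]_(t in `[pi, b]) expR (- (V * t ^+ 2 / 2)) <= V^-1.
Proof.
move=> V0 pib.
apply: (@le_trans _ _
    (\int[mu]_(t in `[pi, b]) (t * expR (- (V * t ^+ 2 / 2))))).
  apply: le_Rintegral => //.
  - apply: continuous_integrable; apply: derivable_continuous => t.
    exact: ex_derive.
  - apply: continuous_integrable; apply: derivable_continuous => t.
    exact: ex_derive.
  - move=> t /=; rewrite in_itv/= => /andP[pit _].
    rewrite -[leLHS]mul1r ler_wpM2r ?expR_ge0//.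
    by have := pi_ge2 R; lra.
pose F t := - (V^-1 * expR (- (V * t ^+ 2 / 2))).
have dF t : is_derive t 1 F (t * expR (- (V * t ^+ 2 / 2))).
  rewrite /F; apply: is_derive_eq; rewrite /GRing.scale/=.
  by field; rewrite gt_eqF.
rewrite (Rintegral_FTC pib dF).
- rewrite /F opprK addrC lerBlDr -[leLHS]mulr1.
  apply: (@le_trans _ _ V^-1).
    have iV : 0 <= V^-1 by rewrite invr_ge0 ltW.
    rewrite mulr1 ler_piMr// -[leRHS]expR0 ler_expR oppr_le0.
    by rewrite divr_ge0// mulr_ge0 ?sqr_ge0 ?ltW.
  by rewrite lerDl mulr_ge0 ?expR_ge0 ?invr_ge0 ?ltW.
- by apply: derivable_continuous => t; exact: ex_derive.
Qed.

End Integrals.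

(** * Cosine transform of the truncated Gaussian *)

Section GaussianFourier.
Variable R : realType.
Implicit Types (a b c t x y V T : R).
Local Notation mu := (@lebesgue_measure R).

Lemma continuous_gauss_cos V x :
  continuous (fun t => expR (- (V * t ^+ 2 / 2)) * cos (x * t)).
Proof. by apply: derivable_continuous => t; exact: ex_derive. Qed.

Lemma continuous_id_gauss_sin V x :
  continuous (fun t => t * expR (- (V * t ^+ 2 / 2)) * sin (x * t)).
Proof. by apply: derivable_continuous => t; exact: ex_derive. Qed.

(** A finite [T] provides a constant dominating function for differentiation in [x]; the limit in
    [T] is taken only at the end. *)
Definition gauss_cos V T x : R :=
  \int[mu]_(t in `[0, T]) (expR (- (V * t ^+ 2 / 2)) * cos (x * t)).

(** Differentiation under the integral, then integration by parts in [t], gives a linear first-order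
    equation with a boundary term at [T]. *)
Lemma is_derive_gauss_cos V T x : 0 < V -> 0 < T ->
  is_derive x 1 (gauss_cos V T)
    (V^-1 * (expR (- (V * T ^+ 2 / 2)) * sin (x * T) - x * gauss_cos V T x)).
Proof.
move=> V0 T0.
pose f y t : R := expR (- (V * t ^+ 2 / 2)) * cos (y * t).
have df y t : is_derive y 1 (f ^~ t)
    (- (t * expR (- (V * t ^+ 2 / 2)) * sin (y * t))).
  by apply: is_derive_eq; rewrite /GRing.scale/=; ring.
have d1 y t : partial1of2 f y t =
    - (t * expR (- (V * t ^+ 2 / 2)) * sin (y * t)).
  by rewrite partial1of2E derive_val.
have Ix : `]x - 1, x + 1[%classic x by rewrite /= in_itv/=; lra.
have intf y : `]x - 1, x + 1[%classic y -> mu.-integrable `[0, T] (EFin \o f y).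
  by move=> _; apply: continuous_integrable; exact: continuous_gauss_cos.
have derf y t : `]x - 1, x + 1[%classic y ->
    `[0, T]%classic t -> derivable (f ^~ t) y 1.
  by move=> _ _; exact: ex_derive.
have intG : mu.-integrable `[0, T] (EFin \o (fun=> T)).
  by apply: continuous_integrable; exact: cst_continuous.
have Gub y t : `]x - 1, x + 1[%classic y ->
    `[0, T]%classic t -> `|partial1of2 f y t| <= T.
  move=> _ /=; rewrite in_itv/= => /andP[t0 tT].
  rewrite d1 normrN !normrM (ger0_norm t0) (ger0_norm (expR_ge0 _)).
  rewrite -[leRHS]mulr1 ler_pM ?mulr_ge0 ?expR_ge0 ?sin_max//.
  rewrite -[leRHS]mulr1 ler_pM ?expR_ge0// -[leRHS]expR0 ler_expR oppr_le0.
  by rewrite divr_ge0// mulr_ge0 ?sqr_ge0 ?ltW.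
have T0' : 0 <= T by exact: ltW.
have mT : measurable (`[0, T]%classic : set (measurableTypeR R)).
  exact: measurable_itv.
apply: DeriveDef.
  by apply: (@derivable_under_integral R _ _ mu f _ mT x (x - 1) (x + 1) Ix
    intf derf (fun=> T)).
rewrite -derive1E.
rewrite (@differentiation_under_integral R _ _ mu f _ mT x (x - 1) (x + 1) Ix
    intf derf (fun=> T))//.
under eq_Rintegral do rewrite d1.
have cI := @continuous_gauss_cos V x; have cJ := @continuous_id_gauss_sin V x.
have cZ k (g : R -> R) : continuous g -> continuous (fun t => k * g t).
  by move=> cg t; apply: cvgMl_tmp; exact: cg.
have iJ := @continuous_integrable _ _ 0 T cJ.
have iI := @continuous_integrable _ _ 0 T cI.
(* The integration by parts; the boundary term at 0 vanishes with the sine. *)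
have := Rintegral_FTC T0 (is_derive_gauss_sin V x).
rewrite mulr0 sin0 mulr0 subr0 => <-; last first.
  by move=> t; exact: (cvgB (cZ x _ cI t) (cZ V _ cJ t)).
rewrite RintegralB//; [|exact/continuous_integrable/cZ..].
rewrite !RintegralZl//.
rewrite -/(gauss_cos V T x) addrAC subrr add0r mulrN mulrA mulVf ?gt_eqF// mul1r.
have -> :
  \int[mu]_(t in `[0, T]) - (t * expR (- (V * t ^+ 2 / 2)) * sin (x * t)) =
   \int[mu]_(t in `[0, T]) (-1 * (t * expR (- (V * t ^+ 2 / 2)) * sin (x * t))).
  by apply: eq_Rintegral => t _; rewrite mulN1r.
by rewrite RintegralZl// mulN1r.
Qed.

Lemma gauss_cosN V T x : gauss_cos V T (- x) = gauss_cos V T x.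
Proof. by apply: eq_Rintegral => t _; rewrite mulNr cosN. Qed.

(** The integrating factor [exp (y^2 / (2 V))] leaves only the boundary term of the differential
    equation, which the mean value theorem then bounds. *)
Lemma gauss_cos_sub_le V T x : 0 < V -> 0 < T ->
  `|gauss_cos V T x - expR (- (x ^+ 2 / (2 * V))) * gauss_cos V T 0|
    <= `|x| * (V^-1 * expR (- (V * T ^+ 2 / 2))).
Proof.
move=> V0 T0; wlog x0 : x / 0 <= x.
  move=> H; have [/H//|/ltW x0] := leP 0 x.
  by have := H (- x); rewrite oppr_ge0 gauss_cosN sqrrN normrN => /(_ x0).
have V00 : V != 0 by rewrite gt_eqF.
have iV : 0 <= V^-1 by rewrite invr_ge0 ltW.
pose E y := expR (y ^+ 2 / (2 * V)) * gauss_cos V T y.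
pose dE y := expR (y ^+ 2 / (2 * V)) *
  (V^-1 * expR (- (V * T ^+ 2 / 2))) * sin (y * T).
have dEP y : is_derive y 1 E (dE y).
  have := is_derive_gauss_cos y V0 T0 => dI.
  rewrite /E; apply: is_derive_eq; rewrite /dE /GRing.scale/=.
  by field; rewrite V00.
have cE : {within `[0, x], continuous E}.
  apply: continuous_subspaceT; apply: derivable_continuous => y.
  exact: ex_derive.
have [c] := MVT_segment x0 (fun y _ => dEP y) cE.
rewrite in_itv/= => /andP[c0 cx] Ec.
have E0 : E 0 = gauss_cos V T 0 by rewrite /E expr0n/= mul0r expR0 mul1r.
have -> : gauss_cos V T x - expR (- (x ^+ 2 / (2 * V))) * gauss_cos V T 0 =
    expR (- (x ^+ 2 / (2 * V))) * (E x - E 0).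
  by rewrite E0 /E mulrBr mulrA -expRD addNr expR0 mul1r.
rewrite Ec subr0 /dE !normrM !(ger0_norm (expR_ge0 _)) (ger0_norm iV).
rewrite (ger0_norm x0).
rewrite mulrA [leRHS]mulrC ler_wpM2r// mulrA -[leRHS]mulr1.
rewrite ler_pM ?mulr_ge0 ?expR_ge0 ?sin_max//.
(* The mean value point satisfies [c <= x], so the two quadratic exponentials multiply to at most
   1. *)
rewrite mulrA -expRD ler_piMl ?mulr_ge0 ?expR_ge0// -[leRHS]expR0 ler_expR.
rewrite addrC subr_le0 ler_pM2r ?invr_gt0 ?mulr_gt0//.
by rewrite ler_sqr ?nnegrE.
Qed.

(** Half the total mass of the centred normal density of variance [1 / V], divided by its peak. *)
Lemma integral0y_gauss_scaled V : 0 < V ->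
  (\int[mu]_(t in `[0%R, +oo[) (expR (- (V * t ^+ 2 / 2)))%:E)%E =
  (Num.sqrt (pi / (2 * V)))%:E.
Proof.
move=> V0; pose sg := (Num.sqrt V)^-1.
have sgV : sg ^+ 2 = V^-1 by rewrite exprVn sqr_sqrtr ?ltW.
have sg0 : sg != 0 by rewrite invr_eq0 gt_eqF// sqrtr_gt0.
have := integral_normal_pdf 0 sg.
rewrite (normal_pdfE _ sg0).
have pk : normal_peak sg = (2 * Num.sqrt (pi / (2 * V)))^-1.
  rewrite /normal_peak sgV; congr (_^-1).
  have -> : V^-1 * pi *+ 2 = 2 ^+ 2 * (pi / (2 * V)).
    by rewrite -mulr_natr; field; rewrite gt_eqF.
  by rewrite sqrtrM ?sqr_ge0// sqrtr_sqr ger0_norm.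
have pk0 : normal_peak sg != 0 by rewrite gt_eqF// normal_peak_gt0.
under eq_integral do rewrite EFinM.
have nf t : normal_fun 0 sg t = expR (- (V * t ^+ 2 / 2)).
  rewrite /normal_fun sgV subr0 -mulr_natr; congr expR.
  by field; rewrite gt_eqF.
under eq_integral do rewrite nf.
rewrite ge0_integralZl//=; first last.
- by rewrite lee_fin normal_peak_ge0.
- apply/measurable_EFinP; apply: continuous_measurable_fun.
  by apply: derivable_continuous => t; exact: ex_derive.
rewrite ge0_symfun_integralT//=; first last.
- by move=> t /=; rewrite sqrrN.
- by apply: derivable_continuous => t; exact: ex_derive.
rewrite (_ : [set x | 0 <= x] = `[0, +oo[%classic); last first.
  by apply/seteqP; split => t/=; rewrite in_itv/= andbT.
set J := (\int[_]_(_ in _) _)%E.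
have J0 : (0 <= J)%E by apply: integral_ge0 => t _; rewrite lee_fin expR_ge0.
have sq0 : 0 < Num.sqrt (pi / (2 * V)).
  by rewrite sqrtr_gt0 divr_gt0 ?pi_gt0 ?mulr_gt0.
case: J J0 => [r| |]//= _.
  rewrite -!EFinM => -[]; rewrite pk; set k := Num.sqrt _ in sq0 * => h.
  congr EFin; rewrite -[RHS]mulr1 -h; field.
  by rewrite gt_eqF.
(* An infinite integral times the positive peak could not equal 1. *)
rewrite mulry gtr0_sg// mul1e mulry gtr0_sg ?mul1e//.
by rewrite normal_peak_gt0.
Qed.

(** Extending the segment to [0, n] costs a tail of at most [1 / V]; there the transform is Gaussian
    up to a boundary term that vanishes as [n] grows. *)
Lemma gauss_cos_pi V x : 0 < V ->
  `|gauss_cos V pi x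
    - Num.sqrt (pi / (2 * V)) * expR (- (x ^+ 2 / (2 * V)))| <= V^-1.
Proof.
move=> V0; have iV : 0 <= V^-1 by rewrite invr_ge0 ltW.
have cg := @continuous_gauss_cos V.
have ce : continuous (fun t => expR (- (V * t ^+ 2 / 2))).
  by apply: derivable_continuous => t; exact: ex_derive.
have cvgI : gauss_cos V n%:R 0 @[n --> \oo] --> Num.sqrt (pi / (2 * V)).
  have := @ge0_cvgn_integral R mu _ (fun t => expR_ge0 (- (V * t ^+ 2 / 2)))
    (continuous_measurable_fun ce).
  rewrite (integral0y_gauss_scaled V0) => /fine_cvg.
  apply: cvg_trans; apply: near_eq_cvg; near=> n.
  apply: eq_Rintegral => t _; by rewrite mul0r cos0 mulr1.
(* Since [n <= n^2], the boundary factor [exp (- V n^2 / 2)] is at most [r ^+ n], a geometric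
   sequence. *)
pose r := expR (- (V / 2)).
have r1 : `|r| < 1.
  by rewrite ger0_norm ?expR_ge0// -expR0 ltr_expR oppr_lt0 divr_gt0.
have le_n (n : nat) : (4 <= n)%N ->
    `|gauss_cos V pi x - expR (- (x ^+ 2 / (2 * V))) * gauss_cos V n%:R 0|
      <= V^-1 + `|x| * V^-1 * r ^+ n.
  move=> n4.
  have n4R : 4 <= n%:R :> R by rewrite ler_nat.
  have pin : pi < n%:R :> R by have := pihalf_lt2 R; lra.
  have n0 : 0 < n%:R :> R by lra.
  have -> : gauss_cos V pi x - expR (- (x ^+ 2 / (2 * V))) * gauss_cos V n%:R 0
    = - (gauss_cos V n%:R x - gauss_cos V pi x) +
      (gauss_cos V n%:R x - expR (- (x ^+ 2 / (2 * V))) * gauss_cos V n%:R 0).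
    by ring.
  apply: (le_trans (ler_normD _ _)); apply: lerD.
    rewrite normrN /gauss_cos Rintegral_itvB//=; last 3 first.
    - exact/continuous_integrable/cg.
    - by rewrite bnd_simp pi_ge0.
    - by rewrite bnd_simp ltW.
    have iocg : mu.-integrable `]pi, n%:R]
        (EFin \o (fun t => expR (- (V * t ^+ 2 / 2)) * cos (x * t))).
      apply: (@integrableS _ _ R mu `[pi, n%:R]) => //.
        exact: subset_itv_oc_cc.
      exact/continuous_integrable/cg.
    rewrite Rintegral_itv_obnd_cbnd//.
    apply: (le_trans _ (Rintegral_gauss_tail_le V0 pin)).
    apply: (le_trans (le_normr_Rintegral _ _)) => //.
      exact/continuous_integrable/cg.
    apply: le_Rintegral => //.
    - apply: continuous_integrable => t; apply: cvg_norm; exact: cg.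
    - exact: continuous_integrable.
    - move=> t _; rewrite normrM ger0_norm ?expR_ge0// ler_piMr ?expR_ge0//.
      exact: cos_max.
  apply: (le_trans (gauss_cos_sub_le x V0 n0)).
  rewrite -[leRHS]mulrA ler_wpM2l// ler_wpM2l// /r -expRM_natr ler_expR mulNr lerN2.
  rewrite mulrAC ler_wpM2r ?invr_ge0// ler_wpM2l ?(ltW V0)//.
  by rewrite expr2 ler_peMl// ltW//; lra.
rewrite [Num.sqrt _ * _]mulrC.
have cvgD' : gauss_cos V pi x
    - expR (- (x ^+ 2 / (2 * V))) * gauss_cos V n%:R 0 @[n --> \oo] -->
    gauss_cos V pi x - expR (- (x ^+ 2 / (2 * V))) * Num.sqrt (pi / (2 * V)).
  by apply: cvgB; [exact: cvg_cst|exact: cvgMl_tmp].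
apply: (@ler_cvg_to _ \oo _ _
  (fun n : nat => `|gauss_cos V pi x
     - expR (- (x ^+ 2 / (2 * V))) * gauss_cos V n%:R 0|)
  (fun n : nat => V^-1 + `|x| * V^-1 * r ^+ n)).
- exact: (cvg_norm cvgD').
- rewrite -[X in _ --> X]addr0; apply: cvgD; first exact: cvg_cst.
  rewrite -(mulr0 (`|x| * V^-1)); apply: cvgMl_tmp; exact: cvg_expr.
- by near=> n; apply: le_n; near: n; exact: nbhs_infty_ge.
Unshelve. all: by end_near. Qed.

End GaussianFourier.

(** * Moments and local limit theorem for Bernoulli sums *)

Section LocalLimit.
Variable R : realType.
Implicit Types (s : seq R) (p : {poly R}).
Local Notation mu := (@lebesgue_measure R).

(** Coefficients beyond the size vanish, so sums may run over a fixed range such as all candidate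
    matching sizes. *)
Lemma sum_coef_wide p (F : nat -> R) n (P : pred nat) : (size p <= n)%N ->
  \sum_(k < n | P k) p`_k * F k = \sum_(k < size p | P k) p`_k * F k.
Proof.
move=> pn; rewrite (big_ord_widen_cond n P (fun k => p`_k * F k) pn).
rewrite [LHS](bigID (fun k : 'I_n => (k < size p)%N))/=.
rewrite [X in _ + X]big1 ?addr0// => k /andP[_].
by rewrite -leqNgt => /(nth_default 0) ->; rewrite mul0r.
Qed.

Lemma horner1_deriv p n : (size p <= n)%N ->
  p^`().[1] = \sum_(k < n) p`_k * k%:R.
Proof.
move=> pn; rewrite (sum_coef_wide (fun k => k%:R) (fun=> true))//.
rewrite -[in LHS](coefK p) poly_def.
rewrite raddf_sum horner_sum; apply: eq_bigr => k _.
by rewrite /= derivZ derivXn hornerZ hornerMn hornerXn expr1n.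
Qed.

Lemma horner1_deriv2 p n : (size p <= n)%N ->
  p^`()^`().[1] = \sum_(k < n) p`_k * (k%:R * (k%:R - 1)).
Proof.
move=> pn.
rewrite (sum_coef_wide (fun k => k%:R * (k%:R - 1)) (fun=> true))//.
rewrite -[in LHS](coefK p) poly_def !raddf_sum horner_sum.
apply: eq_bigr => -[[|k] kp] _ /=.
  by rewrite derivZ derivXn mulr0n scaler0 raddf0 horner0 mul0r mulr0.
rewrite !(derivZ, derivXn, derivMn) hornerZ !hornerMn hornerXn expr1n.
by rewrite /= -[in _ - _]natr1 addrK mulr_natl.
Qed.

(** Product rule at 1, one factor at a time; the second derivative there is the factorial moment
    [E[X (X - 1)]]. *)
Lemma bernoulli_poly_derivs s :
  (bernoulli_poly s)^`().[1] = bernoulli_mean s /\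
  (bernoulli_poly s)^`()^`().[1] =
    bernoulli_mean s ^+ 2 - bernoulli_mean s + bernoulli_variance s.
Proof.
elim: s => [|q s [IH1 IH2]].
  rewrite /bernoulli_poly /bernoulli_mean /bernoulli_variance !big_nil.
  by rewrite !derivC !hornerC expr0n/= subr0 addr0.
have -> : bernoulli_poly (q :: s) = ((1 - q)%:P + q *: 'X) * bernoulli_poly s.
  by rewrite /bernoulli_poly big_cons.
have -> : bernoulli_mean (q :: s) = q + bernoulli_mean s.
  by rewrite /bernoulli_mean big_cons.
have -> : bernoulli_variance (q :: s) = q * (1 - q) + bernoulli_variance s.
  by rewrite /bernoulli_variance big_cons.
have dL : ((1 - q)%:P + q *: 'X)^`() = q%:P.
  by rewrite derivD derivC add0r derivZ derivX alg_polyC.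
rewrite derivM dL derivD !derivM dL derivC mul0r add0r.
by rewrite !hornerE IH1 IH2 bernoulli_poly1 /=; split; ring.
Qed.

Lemma bernoulli_poly_moments s n : (size (bernoulli_poly s) <= n)%N ->
  let p := bernoulli_poly s in
  \sum_(k < n) p`_k * k%:R = bernoulli_mean s /\
  \sum_(k < n) p`_k * (k%:R - bernoulli_mean s) ^+ 2 = bernoulli_variance s.
Proof.
move=> sn p; have [d1 d2] := bernoulli_poly_derivs s.
rewrite -horner1_deriv//; split=> //.
have p1 : \sum_(k < n) p`_k = 1.
  rewrite -(bernoulli_poly1 s) (horner_coef_wide _ sn).
  by apply: eq_bigr => k _; rewrite expr1n mulr1.
transitivity (\sum_(k < n) (p`_k * (k%:R * (k%:R - 1))
   + (1 - 2 * bernoulli_mean s) * (p`_k * k%:R)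
   + bernoulli_mean s ^+ 2 * p`_k)).
  by apply: eq_bigr => k _; ring.
rewrite !big_split/= -!mulr_sumr p1 -horner1_deriv// d1 -horner1_deriv2// d2.
ring.
Qed.

(** Fourier inversion writes [pi] times the probability as an integral over [0, pi]. Replacing the
    characteristic function by the Gaussian one costs [64 / (3 V)], and evaluating the Gaussian
    integral costs [1 / V]. *)
Lemma bernoulli_poly_local_limit s n (m : int) :
  (size (bernoulli_poly s) <= n)%N ->
  {in s, forall q, 0 <= q <= 1} -> 0 < bernoulli_variance s ->
  `| \sum_(k < n | k%:Z == m) (bernoulli_poly s)`_k
     - (Num.sqrt (2 * pi * bernoulli_variance s))^-1
       * expR (- ((m%:~R - bernoulli_mean s) ^+ 2
                  / (2 * bernoulli_variance s))) |
  <= 23 / (pi * bernoulli_variance s).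
Proof.
move=> sn s01 V0; set V := bernoulli_variance s in V0 *.
have iV : 0 <= V^-1 by rewrite invr_ge0 ltW.
set x : R := m%:~R - bernoulli_mean s; set p := bernoulli_poly s.
have pi0 := pi_gt0 R.
pose S (t : R) : R := \sum_(k < n) p`_k * cos ((k%:R - m%:~R) * t).
have IS : \int[mu]_(t in `[0, pi]) S t =
    pi * \sum_(k < n | k%:Z == m) p`_k.
  exact: (Rintegral_cos_sum n (fun k => p`_k) m).
have cS : continuous S.
  apply: derivable_continuous => t.
  have -> : S = \sum_(k < n) (fun t => p`_k * cos ((k%:R - m%:~R) * t)).
    by apply/funext => u; rewrite fct_sumE.
  by apply: derivable_sum => k; exact: ex_derive.
have cg := @continuous_gauss_cos R V x.
have cb : continuous (fun t : R =>
    2 / 3 * V * (t ^+ 3 * expR (- (V * t ^+ 2 / 8)))).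
  by apply: derivable_continuous => t; exact: ex_derive.
have cb' : continuous (fun t : R => t ^+ 3 * expR (- (V * t ^+ 2 / 8))).
  by apply: derivable_continuous => t; exact: ex_derive.
have bound t : `[0, pi]%classic t ->
    `|S t - expR (- (V * t ^+ 2 / 2)) * cos (x * t)| <=
    2 / 3 * V * (t ^+ 3 * expR (- (V * t ^+ 2 / 8))).
  rewrite /= in_itv/= => tpi; rewrite [leRHS]mulrA.
  have := char_sub_gauss_le m%:~R s01 tpi.
  by rewrite /S
    (@sum_coef_wide p (fun k => cos ((k%:R - m%:~R) * t)) n (fun=> true)).
have main : `|pi * \sum_(k < n | k%:Z == m) p`_k - gauss_cos V pi x|
    <= 64 / 3 * V^-1.
  rewrite -IS /gauss_cos -RintegralB//; [|exact: continuous_integrable..].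
  apply: (le_trans (le_normr_Rintegral _ _)) => //.
    apply: continuous_integrable => t; exact: (cvgB (cS t) (cg t)).
  apply: (@le_trans _ _ (\int[mu]_(t in `[0, pi])
      (2 / 3 * V * (t ^+ 3 * expR (- (V * t ^+ 2 / 8)))))).
    apply: le_Rintegral => //.
    - apply: continuous_integrable => t; apply: cvg_norm.
      exact: (cvgB (cS t) (cg t)).
    - exact: continuous_integrable.
  rewrite RintegralZl//; last exact: continuous_integrable.
  have V23 : 0 <= 2 / 3 * V by rewrite mulr_ge0// ltW.
  apply: (le_trans (ler_wpM2l V23 (Rintegral_cube_gauss_le V0))).
  rewrite le_eqVlt; apply/orP; left; apply/eqP; field.
  by rewrite gt_eqF.
have G := gauss_cos_pi x V0.
have sq0 : 0 < Num.sqrt (2 * pi * V) by rewrite sqrtr_gt0 !mulr_gt0.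
(* The half-line Gaussian mass is [pi] times the peak of the normal density. *)
have sqE : Num.sqrt (pi / (2 * V)) = pi * (Num.sqrt (2 * pi * V))^-1.
  have -> : pi / (2 * V) = pi ^+ 2 * (2 * pi * V)^-1.
    by move: (pi : R) pi0 => c c0; field; rewrite !gt_eqF.
  by rewrite sqrtrM ?sqr_ge0// sqrtr_sqr ger0_norm ?pi_ge0// sqrtrV// !mulr_ge0// ltW.
rewrite sqE in G.
have -> : 23 / (pi * V) = pi^-1 * (23 * V^-1).
  by move: (pi : R) pi0 => c c0; field; rewrite !gt_eqF.
rewrite -ler_pdivrMl ?invr_gt0// invrK -[X in X * _](ger0_norm (pi_ge0 R)).
rewrite -normrM mulrBr mulrA.
(* [64 / 3 + 1 = 67 / 3] is rounded up to 23. *)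
apply: (@le_trans _ _ (64 / 3 * V^-1 + V^-1)); last by lra.
rewrite -[X in `|X|](subrKA (gauss_cos V pi x)).
by apply: (le_trans (ler_normD _ _)); exact: lerD.
Qed.

End LocalLimit.

(** * Random variables whose law is carried by finitely many naturals *)

Section FiniteLaw.
Context (d : measure_display) (T : measurableType d) (R : realType).
Variables (P : probability T R) (X : {RV P >-> R}) (n : nat) (p : nat -> R).
Hypothesis law : forall k, P [set w | X w = k%:R] = (p k)%:E.
Hypothesis sum_law : \sum_(k < n) p k = 1.

Let value_set (k : nat) : set T := [set w | X w = k%:R].

Let measurable_value_set k : measurable (value_set k).
Proof. exact: (measurable_funPTI X (measurable_set1 (k%:R : R))). Qed.

Let support : set T := \big[setU/set0]_(k < n) value_set k.

Let measurable_support : measurable support.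
Proof. exact: bigsetU_measurable. Qed.

(** The value sets are disjoint and their masses already add up to 1. *)
Let probability_supportC : P (~` support) = 0%E.
Proof.
rewrite probability_setC// measure_semi_additive_ord//; last first.
  apply/trivIsetP => i j _ _ ij; apply/seteqP; split=> // w [].
  rewrite /value_set/= => -> /eqP.
  by rewrite eqr_nat => /eqP/val_inj/eqP; rewrite (negbTE ij).
rewrite (eq_bigr (fun k : 'I_n => (p k)%:E)); last by move=> k _; exact: law.
by rewrite sumEFin sum_law subee.
Qed.

(** When [m] is negative or at least [n], the event lies in the null complement of the support and
    the sum is empty. *)
Lemma finite_law_int (m : int) :
  fine (P [set w | X w = m%:~R]) = \sum_(k < n | k%:Z == m) p k.
Proof.
have outside (A : set T) : measurable A -> A `<=` ~` support -> P A = 0%E.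
  move=> mA AS; apply/eqP; rewrite -measure_le0 -probability_supportC.
  by apply: le_measure; rewrite ?inE//; exact: measurableC.
have out_val m' : (forall k : 'I_n, k%:Z != m') ->
    P [set w | X w = m'%:~R] = 0%E.
  move=> km; apply: outside.
    exact: (measurable_funPTI X (measurable_set1 (m'%:~R : R))).
  move=> w /= Xw; rewrite /support -bigcup_mkord => -[k /= kn] /eqP.
  by rewrite Xw pmulrn eqr_int eq_sym; exact/negP/(km (Ordinal kn)).
have [/existsP[k /eqP km]|] := boolP [exists k : 'I_n, k%:Z == m].
  rewrite (big_pred1 k); last by move=> j; rewrite -km /=.
  by rewrite -km -pmulrn law.
rewrite negb_exists => /forallP km.
by rewrite out_val// big_pred0// => k; exact/negbTE/km.
Qed.

(** Almost everywhere, [f (X w)] is a finite combination of indicators of the value sets. *)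
Lemma finite_law_integral (f : R -> R) : measurable_fun setT f ->
  (\int[P]_w (f (X w))%:E = (\sum_(k < n) f k%:R * p k)%:E)%E.
Proof.
move=> mf.
have mfk k : measurable_fun setT (fun w => (f k%:R * \1_(value_set k) w)%:E).
  by apply/measurable_EFinP; apply: measurable_funM => //; exact: measurable_indic.
have intk k : P.-integrable setT (fun w => (f k%:R * \1_(value_set k) w)%:E).
  under eq_fun do rewrite EFinM.
  by apply: integrableZl => //; exact: integrable_indic.
rewrite (@ae_eq_integral _ _ _ _ _
    (fun w => \sum_(k < n) (f k%:R * \1_(value_set k) w)%:E)%E)//=.
- rewrite integral_sum//= -sumEFin; apply: eq_bigr => k _.
  under eq_integral do rewrite EFinM.
  rewrite integralZl//; last exact: integrable_indic.
  by rewrite integral_indic// setIT EFinM -law.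
- by apply/measurable_EFinP; exact: measurableT_comp.
- by apply: emeasurable_sum => k; exact: mfk.
- exists (~` support); split=> //; first exact: measurableC.
  move=> w /= /not_implyP[_] neq; apply: contra_not neq.
  rewrite /support -bigcup_mkord => -[k /= kn Xk].
  rewrite (bigD1 (Ordinal kn))//= big1 ?adde0.
    by rewrite indicE mem_set ?mulr1// Xk.
  move=> j jk; rewrite indicE memNset ?mulr0// /value_set/= Xk => /eqP.
  rewrite eqr_nat => /eqP kj; move/eqP: jk; apply; exact/val_inj.
Qed.

Lemma finite_law_expectation : 'E_P[X]%E = (\sum_(k < n) k%:R * p k)%:E.
Proof. by rewrite expectation_def (finite_law_integral (@measurable_id _ _ _)). Qed.

Lemma finite_law_variance : 'V_P[X]%E =
  (\sum_(k < n) (k%:R - fine 'E_P[X]) ^+ 2 * p k)%:E.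
Proof.
rewrite /variance covariance.unlock; set c := fine _.
rewrite expectation.unlock -(@finite_law_integral (fun x => (x - c) ^+ 2)).
  by apply: eq_integral => w _ /=; rewrite expr2.
by apply: measurable_funX; exact: measurable_funB.
Qed.

End FiniteLaw.

(** * Sums over matchings grouped by size *)

Section MatchingLaw.
Variables (R : realType) (G : multigraph).

Lemma sum_num_matchings (F : nat -> R) :
  \sum_(k < #|edge G|.+1) (num_matchings G k)%:R * F k =
  \sum_(M : {set edge G} | is_matching M) F #|M|.
Proof.
pose size_of (M : {set edge G}) : 'I_#|edge G|.+1 := inord #|M|.
have sizeE M : size_of M = #|M| :> nat by rewrite inordK// ltnS max_card.
rewrite (partition_big size_of xpredT)//=; apply: eq_bigr => k _.
rewrite (eq_bigr (fun=> F k)); last by move=> M /andP[_ /eqP <-]; rewrite sizeE.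
rewrite sumr_const mulr_natl; congr (_ *+ _); apply: eq_card => M.
by rewrite !inE -sizeE.
Qed.

Lemma matching_poly1 :
  (matching_poly G R).[1] = \sum_(M : {set edge G} | is_matching M) 1.
Proof.
rewrite -(sum_num_matchings (fun=> 1)) horner_poly.
by apply: eq_bigr => k _; rewrite expr1n.
Qed.

Lemma matching_poly1_gt0 : 0 < (matching_poly G R).[1].
Proof.
rewrite matching_poly1 sumr_const ltr0n; apply/card_gt0P; exists finset.set0.
by rewrite -topredE /=; apply/is_matchingP => e f; rewrite inE.
Qed.

End MatchingLaw.

(** * Gaussian approximation of the matching size *)

Theorem theorem5p1 (R : realType) (G : multigraph)
    (G_nonempty : (0 < #|vertex G|)%N)
    (deg_gt0 : forall v : vertex G, (0 < degree v)%N)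
    (d : measure_display) (Omega : measurableType d)
    (Pr : probability Omega R) (X : {RV Pr >-> R})
    (X_law : forall m : nat,
       Pr [set w | X w = m%:R] =
       ((num_matchings G m)%:R / (matching_poly G R).[1])%:E)
    (card_E_ge : (22 / 10) * 10 ^+ 8 * (max_degree G)%:R ^+ 4
                 <= #|edge G|%:R :> R) :
  let EX := fine 'E_Pr[X] in
  let VX := fine 'V_Pr[X] in
  (ereal_sup [set `| fine (Pr [set w | X w = m%:~R])
                   - (Num.sqrt (2 * pi * VX))^-1
                     * expR (- ((m%:~R - EX) ^+ 2 / (2 * VX))) |%:E
             | m in [set: int]]
   <= (200 * (max_degree G)%:R ^+ 4 / (pi * #|edge G|%:R))%:E)%E.
Proof.
lazy zeta; set EX := fine 'E_Pr[X]%E; set VX := fine 'V_Pr[X]%E.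
have d_gt0 : (0 < max_degree G)%N.
  have /card_gt0P[v _] := G_nonempty.
  exact: leq_trans (deg_gt0 v) (degree_le_max v).
have [s s01 PE] := matching_poly_factor R G.
have N0 := matching_poly1_gt0 R G.
have NE := matching_poly1 R G.
set N := (matching_poly G R).[1] in X_law PE N0 NE *.
pose n := #|edge G|.+1; pose p k : R := (num_matchings G k)%:R / N.
have coefE (k : 'I_n) : (bernoulli_poly s)`_k = p k.
  have := congr1 (fun q : {poly R} => q`_k) PE.
  rewrite coef_poly ltn_ord coefZ /p => ->.
  by rewrite mulrAC divff ?gt_eqF// mul1r.
have size_le : (size (bernoulli_poly s) <= n)%N.
  by rewrite -(size_scale _ (lt0r_neq0 N0)) -PE size_poly.
have sum_law : \sum_(k < n) p k = 1.
  rewrite -mulr_suml; under eq_bigr do rewrite -[_%:R]mulr1.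
  by rewrite (sum_num_matchings G (fun=> 1)) -NE divff// gt_eqF.
(* The point masses of [X] are the coefficients of [bernoulli_poly s], so [X] has the mean and
   variance of the Bernoulli sum. *)
have [mean var] := bernoulli_poly_moments size_le.
have EXE : EX = bernoulli_mean s.
  rewrite /EX (finite_law_expectation X_law sum_law)/= -mean.
  by apply: eq_bigr => k _; rewrite coefE mulrC.
have VXE : VX = bernoulli_variance s.
  rewrite /VX (finite_law_variance X_law sum_law)/= -/EX EXE -var.
  by apply: eq_bigr => k _; rewrite coefE mulrC.
set D : R := (max_degree G)%:R; set E : R := #|edge G|%:R.
have D1 : 1 <= D by rewrite ler1n.
have D0 : 0 < D by lra.
have E0 : 0 < E.
  by apply: lt_le_trans card_E_ge; rewrite !mulr_gt0 ?exprn_gt0 ?invr_gt0.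
(* The second-moment bound over matchings, centred at [EX] and divided by their number [N]. *)
have V_ge : E / (4 * D ^+ 2) <= VX.
  have := sum_matching_sqr_ge EX d_gt0; rewrite -NE -/D -/E.
  rewrite -(sum_num_matchings G (fun k => (k%:R - EX) ^+ 2)).
  rewrite -ler_pdivlMr// => /le_trans; apply.
  rewrite mulr_suml VXE -var EXE le_eqVlt; apply/orP; left; apply/eqP.
  by apply: eq_bigr => k _; rewrite coefE /p mulrAC.
have D2 : 0 < D ^+ 2 by rewrite exprn_gt0//; lra.
have V0 : 0 < VX by apply: lt_le_trans V_ge; rewrite divr_gt0// mulr_gt0.
apply: ge_ereal_sup => _ [m _ <-]; rewrite lee_fin.
rewrite (finite_law_int X_law sum_law) VXE EXE.
rewrite (eq_bigr _ (fun k _ => esym (coefE k))).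
rewrite VXE in V0 V_ge.
apply: (le_trans (bernoulli_poly_local_limit m size_le s01 V0)).
have pi0 := pi_gt0 R.
rewrite ler_pdivrMr ?mulr_gt0// mulrAC ler_pdivlMr ?mulr_gt0//.
rewrite ler_pdivrMr ?mulr_gt0// in V_ge.
set V := bernoulli_variance s in V0 V_ge *.
(* The variance bound gives [23 E <= 92 V D^2], and [D >= 1] raises the power; 92 is below 200. *)
have D24 : D ^+ 2 <= D ^+ 4 by rewrite ler_weXn2l.
have h1 : V * D ^+ 2 <= V * D ^+ 4 by rewrite ler_wpM2l// ltW.
have h2 : 0 <= V * D ^+ 2 by rewrite mulr_ge0 ?ltW.
have h3 : 23 * E <= 200 * (V * D ^+ 4) by lra.
by rewrite mulrCA [leRHS](_ : _ = pi * (200 * (V * D ^+ 4))) ?ler_pM2l//; ring.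
Qed.
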